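(* \textsc{3SAT} is polynomial-time reducible to \textsc{EntrQueryDec}. Here \textsc{EntrQueryDec} is the following problem. Input: a positive integer $K$; an antimonotonic family $\mathcal{F} = \{B_1,\ldots,B_N\}$ of itemsets over the attributes $A=\{a_1,\ldots,a_K\}$, listed explicitly; a vector $\theta=(\theta_1,\ldots,\theta_N)$ of rational numbers that is consistent for $\mathcal{F}$; an itemset $B\subseteq A$; and a rational threshold $b$. Let $f = \hat q(B=1)$, where $\hat q$ is the probability distribution on $\Omega=\{0,1\}^K$ that satisfies the frequencies $\theta$ and has maximal entropy among all such distributions. Question: is $f > b$?
   Context: Let $\Omega = \{0,1\}^K$; the $i$-th coordinate is attribute $a_i$. An itemset is a subset of $A$. A family of itemsets is antimonotonic if every subset of every member also belongs to it. For a distribution $p$ on $\Omega$ and an itemset $B=\{a_{i_1},\ldots,a_{i_L}\}$, $p(B=1)$ denotes $p(a_{i_1}=1,\ldots,a_{i_L}=1)$. A distribution $p$ satisfies frequencies $\theta$ for a family $\{B_1,\ldots,B_N\}$ if $p(B_i=1)=\theta_i$ for all $i$; $\theta$ is consistent if some distribution satisfies it. The entropy of $p$ is $H(p) = -\sum_{\omega\in\Omega} p(\omega)\log p(\omega)$ with the convention $0\log 0 = 0$. \textsc{3SAT} is the satisfiability problem for CNF formulas with (at most) three literals per clause. *)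

(* Defs.v *)
From HB Require Import structures.
From mathcomp Require Import all_boot all_order all_algebra.
From mathcomp Require Import reals exp.

Set Implicit Arguments.
Unset Strict Implicit.
Unset Printing Implicit Defensive.

Import Order.TTheory GRing.Theory Num.Theory.

Definition word := seq bool.

(** Deterministic multi-tape Turing machines.  A cell is blank ([None]), an
    input/output bit ([Some (inl b)]) or a symbol of the finite work alphabet
    of the machine.  All components are finite, so the transition function is
    a finite table; the machine halts when the table has no entry. *)

Variant direction := GoLeft | Stay | GoRight.

Definition cell (W : finType) : Type := option (bool + W).

Record TM := MkTM {
  tm_tapes : nat;  (* the machine has [tm_tapes.+1] tapes *)
  tm_work : finType;
  tm_state : finType;
  tm_start : tm_state;
  tm_trans : tm_state -> {ffun 'I_tm_tapes.+1 -> cell tm_work} ->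
    option (tm_state * {ffun 'I_tm_tapes.+1 -> cell tm_work * direction})
}.

(** A two-way infinite tape: [tape_left] lists the cells to the left of the
    head, nearest first; [tape_right] lists the scanned cell and those to its
    right.  Cells beyond either list are blank. *)
Record tape (W : finType) := Tape {
  tape_left : seq (cell W);
  tape_right : seq (cell W)
}.

Definition tape_read (W : finType) (t : tape W) : cell W :=
  head None (tape_right t).

Definition tape_write (W : finType) (c : cell W) (t : tape W) : tape W :=
  Tape (tape_left t) (c :: behead (tape_right t)).

Definition tape_move (W : finType) (d : direction) (t : tape W) : tape W :=
  match d with
  | GoLeft =>
      Tape (behead (tape_left t)) (head None (tape_left t) :: tape_right t)
  | Stay => t
  | GoRight => Tape (tape_read t :: tape_left t) (behead (tape_right t))
  end.

Definition word_cells (W : finType) (w : word) : seq (cell W) :=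
  [seq Some (inl b) | b <- w].

(** The tape contains [w] and nothing else, with the head on its first cell. *)
Definition tape_holds (W : finType) (t : tape W) (w : word) : Prop :=
  exists m n : nat,
    tape_left t = nseq m None /\
    tape_right t = word_cells W w ++ nseq n None.

Record config (M : TM) := Config {
  cfg_state : tm_state M;
  cfg_tapes : {ffun 'I_(tm_tapes M).+1 -> tape (tm_work M)}
}.

Definition tm_next (M : TM) (c : config M) :=
  tm_trans (cfg_state c) [ffun i => tape_read (cfg_tapes c i)].

Definition tm_halted (M : TM) (c : config M) : Prop := tm_next c = None.

Definition tm_step (M : TM) (c : config M) : config M :=
  if tm_next c is Some (q, act) then
    Config q [ffun i => tape_move (act i).2 (tape_write (act i).1
                                                        (cfg_tapes c i))]
  else c.

Definition tm_init (M : TM) (w : word) : config M :=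
  Config (tm_start M)
    [ffun i => Tape [::] (if i == ord0 then word_cells (tm_work M) w
                          else [::])].

(** The input is given on the first tape and the output is produced on the
    last one. *)
Definition computes_within (M : TM) (w w' : word) (T : nat) : Prop :=
  exists2 t : nat, t <= T &
    let c := iter t (@tm_step M) (tm_init M w) in
    tm_halted c /\ tape_holds (cfg_tapes c ord_max) w'.

(** A decision problem whose inputs are the encodings of the instances that
    satisfy [prob_valid]. *)
Record problem := Problem {
  prob_inst : Type;
  prob_enc : prob_inst -> word;
  prob_enc_inj : injective prob_enc;
  prob_valid : prob_inst -> Prop;
  prob_yes : prob_inst -> Prop
}.

Definition poly_time_reducible (P Q : problem) : Prop :=
  exists f : prob_inst P -> prob_inst Q,
    (forall x, prob_valid x ->
       prob_valid (f x) /\ (prob_yes x <-> prob_yes (f x))) /\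
    exists (M : TM) (p : {poly nat}),
      forall x, prob_valid x ->
        computes_within M (prob_enc x) (prob_enc (f x))
          p.[size (prob_enc x)]%R.

(** All codes below are self-delimiting, so tuples are encoded by mere
    concatenation. *)
Definition prefix_code (T : Type) (e : T -> word) : Prop :=
  forall x y s t, e x ++ s = e y ++ t -> x = y /\ s = t.

Lemma prefix_code_inj (T : Type) (e : T -> word) : prefix_code e -> injective e.
Proof. by move=> eP x y exy; case: (eP x y [::] [::]); rewrite ?exy. Qed.

Definition enc_bool (b : bool) : word := [:: b].

Definition enc_pair (S T : Type) (e : S -> word) (e' : T -> word)
  (x : S * T) : word := e x.1 ++ e' x.2.

Definition enc_list (T : Type) (e : T -> word) (s : seq T) : word :=
  flatten [seq true :: e x | x <- s] ++ [:: false].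

(** Binary digits, least significant first, without superfluous zeros. *)
Fixpoint pos_digits (n : BinNums.positive) : seq bool :=
  match n with
  | BinNums.xH => [:: true]
  | BinNums.xO n' => false :: pos_digits n'
  | BinNums.xI n' => true :: pos_digits n'
  end.

Definition digits (n : nat) : seq bool :=
  if bin_of_nat n is BinNums.Npos p then pos_digits p else [::].

Definition enc_nat (n : nat) : word := enc_list enc_bool (digits n).

Definition enc_int (z : int) : word := (z < 0)%R :: enc_nat `|z|%N.

(** Numerator and denominator of the reduced fraction. *)
Definition enc_rat (r : rat) : word := enc_int (numq r) ++ enc_nat `|denq r|%N.

(** The list of the elements in increasing order. *)
Definition enc_set (n : nat) (B : {set 'I_n}) : word :=
  enc_list enc_nat [seq val i | i <- enum B].

Lemma enc_boolP : prefix_code enc_bool.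
Proof. by move=> x y s t [-> ->]. Qed.

Lemma enc_pairP (S T : Type) (e : S -> word) (e' : T -> word) :
  prefix_code e -> prefix_code e' -> prefix_code (enc_pair e e').
Proof.
move=> eP e'P [x x'] [y y'] s t; rewrite /enc_pair /= -!catA.
by case/eP=> -> /e'P[-> ->].
Qed.

Lemma enc_listP (T : Type) (e : T -> word) :
  prefix_code e -> prefix_code (enc_list e).
Proof.
move=> eP; elim=> [|x u IHu] [|y v] s t; rewrite /enc_list /= -?catA //.
  by case.
by case=> /eP[-> uv]; have [-> ->] := IHu v s t ltac:(by rewrite /enc_list -!catA).
Qed.

Lemma pos_digits_neq0 p : pos_digits p <> [::].
Proof. by case: p. Qed.

Lemma pos_digits_inj : injective pos_digits.
Proof.
elim=> [p IHp|p IHp|] [q|q|] //= [].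
- by move/IHp->.
- by move/pos_digits_neq0.
- by move/IHp->.
- by move/esym/pos_digits_neq0.
Qed.

Lemma digits_inj : injective digits.
Proof.
move=> m n; rewrite /digits => mn; rewrite -[m]bin_of_natK -[n]bin_of_natK.
case: (bin_of_nat m) (bin_of_nat n) mn => [|p] [|q] //.
- by move/esym/pos_digits_neq0.
- by move/pos_digits_neq0.
- by move/pos_digits_inj->.
Qed.

Lemma enc_natP : prefix_code enc_nat.
Proof. by move=> m n s t /(enc_listP enc_boolP)[/digits_inj-> ->]. Qed.

Lemma enc_intP : prefix_code enc_int.
Proof.
move=> x y s t; rewrite /enc_int /= => -[sxy /enc_natP[axy ->]]; split=> //.
by rewrite [x]intEsign [y]intEsign sxy axy.
Qed.

Lemma enc_ratP : prefix_code enc_rat.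
Proof.
move=> x y s t; rewrite /enc_rat -[LHS]catA -[RHS]catA => /enc_intP[nxy /enc_natP[dxy ->]].
split=> //; rewrite -[x]divq_num_den -[y]divq_num_den nxy.
by rewrite -(gez0_abs (ltW (denq_gt0 x))) -(gez0_abs (ltW (denq_gt0 y))) dxy.
Qed.

Lemma enc_setP (n : nat) : prefix_code (@enc_set n).
Proof.
move=> A B s t /(enc_listP enc_natP)[/(inj_map val_inj) AB ->]; split=> //.
by apply/setP=> i; rewrite -mem_enum AB mem_enum.
Qed.

(** [(s, i)] is the variable [x_i] if [s] is true, and its negation otherwise. *)
Definition literal : Type := bool * nat.
Definition clause : Type := seq literal.
Definition cnf : Type := seq clause.

Definition is_3cnf (phi : cnf) : Prop := all (fun C : clause => size C <= 3) phi.

Definition eval_literal (v : nat -> bool) (l : literal) : bool := v l.2 == l.1.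

Definition eval_cnf (v : nat -> bool) (phi : cnf) : bool :=
  all (has (eval_literal v)) phi.

Definition satisfiable (phi : cnf) : Prop := exists v, eval_cnf v phi.

Definition enc_cnf : cnf -> word :=
  enc_list (enc_list (enc_pair enc_bool enc_nat)).

Lemma enc_cnf_inj : injective enc_cnf.
Proof.
apply/prefix_code_inj/enc_listP/enc_listP/enc_pairP; first exact: enc_boolP.
exact: enc_natP.
Qed.

Definition three_sat : problem := Problem enc_cnf_inj is_3cnf satisfiable.

Definition outcome (K : nat) : finType := {ffun 'I_K -> bool}.
Definition itemset (K : nat) : finType := {set 'I_K}.

Definition is_distr (R : realType) (K : nat) (p : outcome K -> R) : Prop :=
  (forall w, 0 <= p w)%R /\ (\sum_(w : outcome K) p w = 1)%R.

Definition prob_all1 (R : realType) (K : nat) (p : outcome K -> R)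
    (B : itemset K) : R :=
  (\sum_(w : outcome K | [forall i in B, w i]) p w)%R.

(** The convention [0 log 0 = 0] is built in, as [0 * ln 0 = 0]. *)
Definition entropy (R : realType) (K : nat) (p : outcome K -> R) : R :=
  (- \sum_(w : outcome K) p w * ln (p w))%R.

Definition antimonotonic (K : nat) (F : seq (itemset K)) : Prop :=
  forall B C : itemset K, B \in F -> C \subset B -> C \in F.

(** A family and its frequencies are given jointly, as a list of pairs
    [(B_i, theta_i)]. *)
Definition satisfies (R : realType) (K : nat) (p : outcome K -> R)
    (F : seq (itemset K * rat)) : Prop :=
  forall c, c \in F -> prob_all1 p c.1 = ratr c.2.

Definition consistent (R : realType) (K : nat)
    (F : seq (itemset K * rat)) : Prop :=
  exists p : outcome K -> R, is_distr p /\ satisfies p F.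

Definition is_maxent (R : realType) (K : nat) (F : seq (itemset K * rat))
    (q : outcome K -> R) : Prop :=
  [/\ is_distr q, satisfies q F &
      forall p : outcome K -> R,
        is_distr p -> satisfies p F -> (entropy p <= entropy q)%R].

Record entr_query := EntrQuery {
  query_dim : nat;
  query_constraints : seq (itemset query_dim * rat);
  query_itemset : itemset query_dim;
  query_threshold : rat
}.

Definition enc_entr_query (I : entr_query) : word :=
  enc_nat (query_dim I) ++
  enc_list (enc_pair (@enc_set _) enc_rat) (query_constraints I) ++
  enc_set (query_itemset I) ++
  enc_rat (query_threshold I).

Lemma enc_entr_query_inj : injective enc_entr_query.
Proof.
move=> [K F B b] [K' F' B' b']; rewrite /enc_entr_query /=.
case/enc_natP=> eqK; subst K'.
case/(enc_listP (enc_pairP (@enc_setP K) enc_ratP))=> -> /enc_setP[-> eb].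
by rewrite (prefix_code_inj enc_ratP eb).
Qed.

Definition entr_query_valid (R : realType) (I : entr_query) : Prop :=
  let F := [seq c.1 | c <- query_constraints I] in
  [/\ 0 < query_dim I, uniq F, antimonotonic F & consistent R (query_constraints I)].

(** For a consistent family the maximum entropy distribution exists (by
    compactness) and is unique (by strict concavity of the entropy). *)
Definition entr_query_yes (R : realType) (I : entr_query) : Prop :=
  exists2 q : outcome (query_dim I) -> R,
    is_maxent (query_constraints I) q &
    (ratr (query_threshold I) < prob_all1 q (query_itemset I))%R.

Definition entr_query_dec (R : realType) : problem :=
  Problem enc_entr_query_inj (entr_query_valid R) (entr_query_yes R).

(* Main.v *)
(* Give each of the three literal slots of a clause an independent uniform bit
   ("this literal is selected"), and add attributes for the negations of these
   bits, for the disjunction of the bits of each clause, and, for any two slots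
   holding opposite literals, for "not both selected".  Each added attribute is
   the negation of a conjunction of other attributes, and such a relation is
   forced on the support of a distribution by frequencies alone: if
   p(P) + p(Q) = 1 and p(P, Q) = 0, then exactly one of P, Q holds wherever p
   is positive.  So every distribution with the prescribed frequencies lives on
   the graph S of a circuit; the uniform distribution on S has these
   frequencies and the largest possible entropy ln |S|.  The query asks for all
   disjunctions, all "not both selected" and the non-selection of missing
   literals; it holds somewhere on S iff the formula is satisfiable, so its
   frequency is positive iff the formula is satisfiable.

   Attributes are indexed by numbers 2^a and 2^a + 2^b, whose codes are written
   from unary counters, and the dimension 2^(7m) is exponential in the number m
   of clauses but has a code of linear length.  The Turing machine is compiled
   from a while-program, tapes being taken up to blank padding. *)
Require Import Defs.
From HB Require Import structures.
From mathcomp Require Import all_boot all_order all_algebra.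
From mathcomp Require Import boolp reals exp.
From mathcomp Require Import zify lra.

Set Implicit Arguments.
Unset Strict Implicit.
Unset Printing Implicit Defensive.

Import Order.TTheory GRing.Theory Num.Theory.

(** * While-programs over five tapes *)

(** An antimonotonic family lists every subset of each member together with its frequency, so a
    relation may involve only boundedly many attributes and its frequencies must be known
    beforehand. Gates on at most three fair bits meet both demands: the subset closure of a gate has
    constant size, and all frequencies are multiples of 1/8 or 1/4. Since the free bits are slots
    rather than variables, every clause has the same table of frequencies, even if a variable
    repeats within it, and the variable numbers never enter the indices. Frequencies speak of
    conjunctions only, which is why a disjunction goes through the negations of its inputs. Indices
    constrained by nothing are further free bits; they enlarge S without affecting any frequency. A
    set is encoded by its elements in increasing order. The indices 2^t and 2^a + 2^t with a < t
    have leading exponent t, so a single pass over the slots meets the queried ones in increasing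
    order, and no arithmetic on binary numbers is required of the machine. The cubic time comes from
    comparing each slot with all earlier ones at linear cost. *)

Variant tape_name := In | Tab | Cnt | Fam | Out.

Definition tape_eqb (t u : tape_name) : bool :=
  match t, u with
  | In, In | Tab, Tab | Cnt, Cnt | Fam, Fam | Out, Out => true
  | _, _ => false
  end.

Lemma tape_eqbP : Equality.axiom tape_eqb.
Proof. by move=> [] []; constructor. Qed.

HB.instance Definition _ := hasDecEq.Build tape_name tape_eqbP.

(** Three work symbols suffice: [hash] marks the current literal in the input, [semi] ends a literal
    code in the table, and [bar] is the unary digit for exponents. *)
Definition sym := cell (option bool).
Definition bit (b : bool) : sym := Some (inl b).
Definition hash : sym := Some (inr None).
Definition semi : sym := Some (inr (Some true)).
Definition bar : sym := Some (inr (Some false)).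

(* A tape up to blank padding: the cells to the left of the head, nearest
   first, and the cells from the head on. *)
Definition atape : Type := (nat -> sym) * (nat -> sym).

Definition zip2 (l r : seq sym) : atape := (nth None l, nth None r).

Definition aread (t : atape) : sym := t.2 0.

Definition awrite (c : option sym) (t : atape) : atape :=
  if c is Some c then (t.1, fun n => if n is m.+1 then t.2 m.+1 else c) else t.

Definition amove (d : direction) (t : atape) : atape :=
  match d with
  | GoLeft => (fun n => t.1 n.+1, fun n => if n is m.+1 then t.2 m else t.1 0)
  | Stay => t
  | GoRight => (fun n => if n is m.+1 then t.1 m else t.2 0, fun n => t.2 n.+1)
  end.

Arguments awrite : simpl never.
Arguments amove : simpl never.
Arguments zip2 : simpl never.
Arguments aread : simpl never.

Lemma zip2_padr l r : zip2 l (rcons r None) = zip2 l r.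
Proof.
congr pair; apply/funext => n; rewrite nth_rcons.
by case: ltnP => // h; rewrite if_same nth_default.
Qed.

Lemma zip2_padl l r : zip2 (rcons l None) r = zip2 l r.
Proof.
congr pair; apply/funext => n; rewrite nth_rcons.
by case: ltnP => // h; rewrite if_same nth_default.
Qed.

Lemma amoveR l c r : amove GoRight (zip2 l (c :: r)) = zip2 (c :: l) r.
Proof. by congr pair; apply/funext => -[|n]. Qed.

Lemma amoveR0 l : amove GoRight (zip2 l [::]) = zip2 (None :: l) [::].
Proof. by rewrite -(zip2_padr l [::]) amoveR. Qed.

Lemma amoveL l c r : amove GoLeft (zip2 (c :: l) r) = zip2 l (c :: r).
Proof. by congr pair; apply/funext => -[|n]. Qed.

Lemma amoveL0 r : amove GoLeft (zip2 [::] r) = zip2 [::] (None :: r).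
Proof. by rewrite -(zip2_padl [::] r) amoveL. Qed.

Lemma awriteE a l c r : awrite (Some a) (zip2 l (c :: r)) = zip2 l (a :: r).
Proof. by congr pair; apply/funext => -[|n]. Qed.

Lemma awrite0 a l : awrite (Some a) (zip2 l [::]) = zip2 l [:: a].
Proof. by rewrite -(zip2_padr l [::]) awriteE. Qed.

(** Roles of the tapes: [Cnt] holds the current exponent in unary, [Tab] the literals met so far
    with the exponents of their slots, [Fam] the code of the family, and [Out] first the code of the
    query, later the whole output. *)
Definition store := tape_name -> atape.
Definition reads (s : store) : tape_name -> sym := fun t => aread (s t).

Definition upd (s : store) (t : tape_name) (x : atape) : store :=
  fun u => if u == t then x else s u.

(** A test sees nothing but the five scanned symbols, so every program has a finite transition
    table. *)
Inductive prog :=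
  | Put of tape_name & option sym & direction
  | Seq of prog & prog
  | If of (tape_name -> sym) -> bool & prog & prog
  | While of (tape_name -> sym) -> bool & prog.

(** The extra point [None] of a conditional or a loop is where its test is evaluated. In a loop it
    coincides with the exit [None] of the body, so leaving the body leads back to the test. *)
Fixpoint point (p : prog) : finType :=
  match p with
  | Put _ _ _ => unit
  | Seq p q => (point p + point q)%type
  | If _ p q => option (point p + point q)
  | While _ p => option (point p)
  end.

Fixpoint entry (p : prog) : point p :=
  match p with
  | Put _ _ _ => tt
  | Seq p q => inl (entry p)
  | If _ p q => None
  | While _ p => None
  end.

Definition action := tape_name -> option sym * direction.
Definition idle : action := fun _ => (None, Stay).

(* The next control point, [None] standing for the exit of the program. *)
Fixpoint next (p : prog) :
    point p -> (tape_name -> sym) -> option (point p) * action :=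
  match p with
  | Put t c d => fun _ _ => (None, fun u => if u == t then (c, d) else (None, Stay))
  | Seq p q => fun s r =>
      match s with
      | inl s => let x := next s r in
          (Some (if x.1 is Some s' then inl s' else inr (entry q)), x.2)
      | inr s => let x := next s r in (omap inr x.1, x.2)
      end
  | If c p q => fun s r =>
      match s with
      | None =>
          (Some (Some (if c r then inl (entry p) else inr (entry q))), idle)
      | Some (inl s) => let x := next s r in (omap (fun s => Some (inl s)) x.1, x.2)
      | Some (inr s) => let x := next s r in (omap (fun s => Some (inr s)) x.1, x.2)
      end
  | While c p => fun s r =>
      match s with
      | None => (if c r then Some (Some (entry p)) else None, idle)
      | Some s => let x := next s r in (Some x.1, x.2)
      end
  end.

Definition perform (a : action) (s : store) : store :=
  fun t => amove (a t).2 (awrite (a t).1 (s t)).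

Inductive reach (p : prog) : nat -> point p -> store -> store -> Prop :=
  | ReachExit x s a : next x (reads s) = (None, a) -> reach 1 x s (perform a s)
  | ReachStep n x y s a s' : next x (reads s) = (Some y, a) ->
      reach n y (perform a s) s' -> reach n.+1 x s s'.

Definition runs (p : prog) (s s' : store) (N : nat) : Prop :=
  exists2 n, n <= N & reach n (entry p) s s'.

Lemma perform_idle s : perform idle s = s.
Proof. by []. Qed.

Lemma runs_le p s s' m n : m <= n -> runs p s s' m -> runs p s s' n.
Proof. by move=> mn [k km h]; exists k => //; apply: leq_trans mn. Qed.

Lemma runs_put t c d s :
  runs (Put t c d) s (upd s t (amove d (awrite c (s t)))) 1.
Proof.
exists 1 => //.
have -> : upd s t (amove d (awrite c (s t))) =
    perform (fun u => if u == t then (c, d) else (None, Stay)) s.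
  by apply/funext => u; rewrite /upd /perform; case: eqP => // ->.
by constructor.
Qed.

(** Times add up exactly: the last action of [p] already moves control to the entry of [q]. *)
Lemma runs_seq p q s s1 s2 m n :
  runs p s s1 m -> runs q s1 s2 n -> runs (Seq p q) s s2 (m + n).
Proof.
case=> k km hp [l ln hq]; exists (k + l); first exact: leq_add.
rewrite /=; move: (entry p) hp => x hp.
have {}hq : reach (p := Seq p q) l (inr (entry q)) s1 s2.
  elim: hq => [y t a e|i y z t a t' e _ IH].
    by apply: ReachExit; rewrite /= e.
  by apply: ReachStep IH; rewrite /= e.
elim: hp hq => [y t a e|i y z t a t' e _ IH] hq.
  by apply: ReachStep hq; rewrite /= e.
by apply: ReachStep (IH hq); rewrite /= e.
Qed.

Lemma runs_if (c : (tape_name -> sym) -> bool) p q s s' n :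
  runs (if c (reads s) then p else q) s s' n -> runs (If c p q) s s' n.+1.
Proof.
case: (boolP (c (reads s))) => hc [k kn h]; exists k.+1 => //.
  apply: (@ReachStep (If c p q) _ _ (Some (inl (entry p))) s idle).
    by rewrite /= hc.
  rewrite perform_idle; elim: h {hc} => [y t a e|i y z t a t' e _ IH].
    by apply: ReachExit; rewrite /= e.
  by apply: ReachStep IH; rewrite /= e.
apply: (@ReachStep (If c p q) _ _ (Some (inr (entry q))) s idle).
  by rewrite /= (negbTE hc).
rewrite perform_idle; elim: h {hc} => [y t a e|i y z t a t' e _ IH].
  by apply: ReachExit; rewrite /= e.
by apply: ReachStep IH; rewrite /= e.
Qed.

Lemma runs_while0 (c : (tape_name -> sym) -> bool) p s :
  ~~ c (reads s) -> runs (While c p) s s 1.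
Proof.
move=> hc; exists 1 => //; rewrite -{2}[s]perform_idle.
by apply: ReachExit; rewrite /= (negbTE hc).
Qed.

Lemma runs_whileS (c : (tape_name -> sym) -> bool) p s s1 s2 m n :
  c (reads s) -> runs p s s1 m -> runs (While c p) s1 s2 n ->
  runs (While c p) s s2 (m + n).+1.
Proof.
move=> hc [k km hp] [l ln hq]; exists (k + l).+1; first by rewrite ltnS leq_add.
apply: (@ReachStep (While c p) _ _ (Some (entry p)) s idle).
  by rewrite /= hc.
rewrite perform_idle; elim: hp hq {hc} => [y t a e|i y z t a t' e _ IH] hq.
  by apply: ReachStep hq; rewrite /= e.
by apply: ReachStep (IH hq); rewrite /= e.
Qed.

(** * Compilation of programs into Turing machines *)

Definition tape_of (i : 'I_5) : tape_name :=
  match val i with 0 => In | 1 => Tab | 2 => Cnt | 3 => Fam | _ => Out end.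

Definition ord_of (t : tape_name) : 'I_5 :=
  match t with
  | In => @Ordinal 5 0 isT | Tab => @Ordinal 5 1 isT | Cnt => @Ordinal 5 2 isT
  | Fam => @Ordinal 5 3 isT | Out => @Ordinal 5 4 isT
  end.

Lemma ord_ofK : cancel ord_of tape_of.
Proof. by case. Qed.

(** The state [None] is the exit of the program and has no transition, hence halts. A machine has to
    write in every step; where the program writes nothing, it rewrites the scanned symbol. *)
Definition machine (p : prog) : TM :=
  @MkTM 4 (option bool) (option (point p)) (Some (entry p)) (fun s r =>
    if s is Some x then
      let y := next x (fun t => r (ord_of t)) in
      Some (y.1, [ffun i => (odflt (r i) (y.2 (tape_of i)).1,
                             (y.2 (tape_of i)).2)])
    else None).

Definition abs_tape (t : tape (option bool)) : atape :=
  zip2 (tape_left t) (tape_right t).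

Definition abs_config (p : prog) (c : config (machine p)) : store :=
  fun t => abs_tape (cfg_tapes c (ord_of t)).

Lemma abs_tape_read t : aread (abs_tape t) = tape_read t.
Proof. by case: t => l []. Qed.

(** Rewriting the scanned blank on an exhausted list makes it one blank longer; this is why tapes
    are compared only up to padding. *)
Lemma abs_tape_write c t :
  abs_tape (tape_write (odflt (tape_read t) c) t) = awrite c (abs_tape t).
Proof.
case: t c => l [|x r] [c|]; rewrite /abs_tape /tape_write /tape_read /=.
- by rewrite awrite0.
- by rewrite -[RHS]zip2_padr.
- by rewrite awriteE.
- by [].
Qed.

Lemma abs_tape_move d t : abs_tape (tape_move d t) = amove d (abs_tape t).
Proof.
case: t d => l r []; rewrite /abs_tape /tape_move /tape_read /=.
- by case: l => [|x l] /=; rewrite ?amoveL0 ?amoveL.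
- by [].
- by case: r => [|x r] /=; rewrite ?amoveR0 ?amoveR.
Qed.

Lemma machine_reach p n x s s' (c : config (machine p)) :
  reach n x s s' -> cfg_state c = Some x -> abs_config c = s ->
  let c' := iter n (@tm_step _) c in
  cfg_state c' = None /\ abs_config c' = s'.
Proof.
have step (y : point p) (d : config (machine p)) : cfg_state d = Some y ->
    let z := next y (reads (abs_config d)) in
    cfg_state (tm_step d) = z.1 /\
    abs_config (tm_step d) = perform z.2 (abs_config d).
  move=> yd /=; rewrite /tm_step /tm_next yd /=.
  have -> : (fun t => [ffun i => tape_read (cfg_tapes d i)] (ord_of t)) =
      reads (abs_config d).
    by apply/funext => t; rewrite ffunE /reads /abs_config abs_tape_read.
  split=> //; apply/funext => t.
  by rewrite /abs_config /perform !ffunE ord_ofK /= abs_tape_move abs_tape_write.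
move=> h; elim: h c => [y t a e|i y z t a t' e _ IH] c hc ht.
  by have [] := step _ _ hc; rewrite ht e.
rewrite iterSr; have [] := step _ _ hc; rewrite ht e => h1 h2.
exact: IH.
Qed.

Definition mk (i t c f o : atape) : store := fun u =>
  match u with In => i | Tab => t | Cnt => c | Fam => f | Out => o end.

Definition blank : atape := zip2 [::] [::].
Definition bits (w : word) : seq sym := word_cells (option bool) w.

Lemma abs_tape_holds t w :
  abs_tape t = zip2 [::] (bits w) -> tape_holds t w.
Proof.
case: t => l r [hl hr]; exists (size l), (size r - size w) => /=.
split.
  apply: (@eq_from_nth _ None); first by rewrite size_nseq.
  by move=> i il; rewrite nth_nseq il hl nth_nil.
(* A shorter list would read blank at a position where [w] has a bit. *)
have sz : size w <= size r.
  rewrite leqNgt; apply/negP => h.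
  have := congr1 (fun f => f (size r)) hr.
  by rewrite /= nth_default // /bits /word_cells (nth_map false).
apply: (@eq_from_nth _ None).
  by rewrite size_cat size_nseq size_map subnKC.
move=> i ir; rewrite hr /bits nth_cat size_map; case: ltnP => // h.
by rewrite nth_default ?size_map // nth_nseq; case: ifP.
Qed.

Lemma runs_computes p w w' N s :
  runs p (mk (zip2 [::] (bits w)) blank blank blank blank) s N ->
  s Out = zip2 [::] (bits w') ->
  computes_within (machine p) w w' N.
Proof.
case=> n nN h hO; exists n => //=.
have [] := machine_reach h (c := tm_init (machine p) w) erefl.
  by apply/funext => -[]; rewrite /abs_config ffunE.
move=> h1 h2; split; first by rewrite /tm_halted /tm_next h1.
apply: abs_tape_holds; rewrite -hO -h2; congr (abs_tape (_ _)).
exact/val_inj.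
Qed.

(** * Binary codes of sums of powers of two *)

(** The code of [n] binary zeros: each digit is preceded by the list marker [true]. Digits come
    least significant first, so multiplying by 2^n prepends this word. *)
Fixpoint tens (n : nat) : word := if n is m.+1 then [:: true, false & tens m] else [::].

Lemma tensS n : tens n.+1 = tens n ++ [:: true; false].
Proof. by elim: n => //= n <-. Qed.

Lemma tensD m n : tens (m + n) = tens m ++ tens n.
Proof. by elim: m => //= m <-. Qed.

Lemma size_tens n : size (tens n) = 2 * n.
Proof. by elim: n => //= n ->; lia. Qed.

Lemma digits_pos p : digits (nat_of_bin (BinNums.Npos p)) = pos_digits p.
Proof. by rewrite /digits nat_of_binK. Qed.

Lemma digitsD (b : bool) n : 0 < n -> digits (b + n.*2) = b :: digits n.
Proof.
rewrite -[n]bin_of_natK; case: (bin_of_nat n) => // p _; rewrite digits_pos.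
have e (x : BinNums.positive) : nat_of_bin (BinNums.Npos x) = nat_of_pos x by [].
case: b.
  have -> : (true + (nat_of_bin (BinNums.Npos p)).*2 =
             nat_of_bin (BinNums.Npos (BinNums.xI p)))%N.
    by rewrite !e /= NatTrec.doubleE; lia.
  by rewrite digits_pos.
have -> : (false + (nat_of_bin (BinNums.Npos p)).*2 =
           nat_of_bin (BinNums.Npos (BinNums.xO p)))%N.
  by rewrite !e /= NatTrec.doubleE; lia.
by rewrite digits_pos.
Qed.

Lemma enc_nat_bit (b : bool) n : 0 < n -> enc_nat (b + n.*2) = true :: b :: enc_nat n.
Proof. by move=> n0; rewrite /enc_nat digitsD. Qed.

Lemma enc_nat_shift k n : 0 < n -> enc_nat (2 ^ k * n) = tens k ++ enc_nat n.
Proof.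
move=> n0; elim: k => [|k IH]; first by rewrite mul1n.
rewrite expnS -mulnA mul2n -[_.*2]add0n.
by rewrite (@enc_nat_bit false) ?IH // muln_gt0 expn_gt0.
Qed.

Lemma enc_nat_exp e : enc_nat (2 ^ e) = tens e ++ [:: true; true; false].
Proof. by rewrite -[2 ^ e]muln1 enc_nat_shift. Qed.

(** After [a] zeros comes the lower one, then the b - a - 1 zeros that separate it from the leading
    one. *)
Lemma enc_nat_exp2 a b : a < b ->
  enc_nat (2 ^ a + 2 ^ b) =
  tens a ++ [:: true; true] ++ tens (b - a.+1) ++ [:: true; true; false].
Proof.
move=> ab; have -> : 2 ^ a + 2 ^ b = 2 ^ a * (true + (2 ^ (b - a.+1)).*2).
  by rewrite mulnDr muln1 -muln2 -expnSr -expnD; congr (_ + 2 ^ _); lia.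
by rewrite enc_nat_shift ?addnS // enc_nat_bit ?expn_gt0 // enc_nat_exp.
Qed.

(** * Program fragments and their running times *)

Lemma bits_cat w w' : bits (w ++ w') = bits w ++ bits w'.
Proof. exact: map_cat. Qed.

Lemma runs_put_seq p t c d s s' n :
  runs p (upd s t (amove d (awrite c (s t)))) s' n ->
  runs (Seq (Put t c d) p) s s' n.+1.
Proof. by move=> h; rewrite -add1n; apply: runs_seq h; apply: runs_put. Qed.

Definition move t d := Put t None d.
Definition emit t b := Put t (Some (bit b)) GoRight.
Definition on t (c : pred sym) : (tape_name -> sym) -> bool := fun r => c (r t).

Lemma awriteN x : awrite None x = x.
Proof. by []. Qed.

Lemma upd_upd s t x y : upd (upd s t x) t y = upd s t y.
Proof. by apply/funext => u; rewrite /upd; case: eqP. Qed.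

Lemma upd_same s t x : s t = x -> upd s t x = s.
Proof. by move=> e; apply/funext => u; rewrite /upd; case: eqP => // ->. Qed.

Lemma updE s t x : upd s t x t = x.
Proof. by rewrite /upd eqxx. Qed.

Lemma aread_zip2 l r : aread (zip2 l r) = head None r.
Proof. by case: r. Qed.

Lemma runs_scan t (c : pred sym) s l x r :
  s t = zip2 l (x ++ r) -> all c x -> ~~ c (head None r) ->
  runs (While (on t c) (move t GoRight)) s (upd s t (zip2 (rev x ++ l) r))
    (2 * size x + 1).
Proof.
elim: x l s => [|a x IH] l s e /=.
  move=> _ cr; rewrite upd_same //; apply: runs_while0.
  by rewrite /on /reads e aread_zip2.
case/andP=> ca cx cr.
have h := IH (a :: l) (upd s t (zip2 (a :: l) (x ++ r))) (updE _ _ _) cx cr.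
have b := runs_put t None GoRight s; rewrite e awriteN amoveR in b.
rewrite upd_upd in h; rewrite rev_cons cat_rcons.
apply: runs_le (runs_whileS _ b h); first lia.
by rewrite /on /reads e aread_zip2.
Qed.

Definition back t c := Seq (move t GoLeft) (While (on t c) (move t GoLeft)).

(** [head None l] and [behead l] treat uniformly the case where the head leaves the listed part of
    the tape and finds a blank there. *)
Lemma runs_back t (c : pred sym) s x l r :
  s t = zip2 (x ++ l) r -> all c x -> ~~ c (head None l) ->
  runs (back t c) s
    (upd s t (zip2 (behead l) (head None l :: rev x ++ r))) (2 * size x + 2).
Proof.
move=> e cx cl.
suff h a y q s' : s' t = zip2 (y ++ l) (a :: q) -> c a -> all c y ->
    runs (While (on t c) (move t GoLeft)) s'
      (upd s' t (zip2 (behead l) (head None l :: rev y ++ a :: q)))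
      (2 * size y + 3).
  have b := runs_put t None GoLeft s; rewrite e awriteN in b.
  case: x cx e b => [|a x] /= cx e.
    have -> : amove GoLeft (zip2 l r) = zip2 (behead l) (head None l :: r).
      by case: l {h cl e} => [|? ?]; rewrite ?amoveL0 ?amoveL.
    move=> b; apply: runs_le (runs_seq b (runs_while0 _ _)) => //.
    by rewrite /on /reads updE aread_zip2.
  case/andP: cx => ca cx; rewrite amoveL => b.
  have {}h := h a x r (upd s t (zip2 (x ++ l) (a :: r))) (updE _ _ _) ca cx.
  rewrite upd_upd in h; rewrite rev_cons cat_rcons.
  by apply: runs_le (runs_seq b h); lia.
elim: y a q s' => [|a' y IH] a q s' e' ca /=.
  move=> _; have b := runs_put t None GoLeft s'; rewrite e' awriteN in b.
  have h : amove GoLeft (zip2 l (a :: q)) =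
      zip2 (behead l) (head None l :: a :: q).
    by case: l {cl e e' b} => [|? ?]; rewrite ?amoveL0 ?amoveL.
  rewrite /= h in b.
  apply: runs_le (runs_whileS _ b (runs_while0 _ _)) => //.
    by rewrite /on /reads e' aread_zip2.
  by rewrite /on /reads updE aread_zip2.
case/andP=> ca' cy; have b := runs_put t None GoLeft s'.
rewrite e' awriteN amoveL in b.
have h := IH a' (a :: q) (upd s' t (zip2 (y ++ l) [:: a', a & q])) (updE _ _ _) ca' cy.
rewrite upd_upd in h; rewrite rev_cons cat_rcons.
apply: runs_le (runs_whileS _ b h); first lia.
by rewrite /on /reads e' aread_zip2.
Qed.

Definition rewind t c := Seq (back t c) (move t GoRight).

Lemma runs_rewind t (c : pred sym) s x l r :
  s t = zip2 (x ++ l) r -> all c x -> ~~ c (head None l) ->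
  runs (rewind t c) s (upd s t (zip2 l (rev x ++ r))) (2 * size x + 3).
Proof.
move=> e cx cl; have h := runs_back e cx cl.
have b := runs_put t None GoRight
  (upd s t (zip2 (behead l) (head None l :: rev x ++ r))).
rewrite updE awriteN amoveR upd_upd in b.
have el : zip2 (head None l :: behead l) (rev x ++ r) = zip2 l (rev x ++ r).
  by case: l {e cl h b} => // ; rewrite -(zip2_padl [::]).
by rewrite el in b; apply: runs_le (runs_seq h b); lia.
Qed.

Definition skip := move In Stay.

Fixpoint emitw t (w : word) : prog :=
  if w is b :: w then Seq (emit t b) (emitw t w) else skip.

Definition written (w : word) : atape := zip2 (rev (bits w)) [::].

Lemma written_rcons w b :
  amove GoRight (awrite (Some (bit b)) (written w)) = written (rcons w b).
Proof.
by rewrite /written awrite0 amoveR /bits /word_cells map_rcons rev_rcons.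
Qed.

Lemma runs_skip s : runs skip s s 1.
Proof.
have := runs_put In None Stay s; rewrite awriteN (_ : upd _ _ _ = s) //.
exact: upd_same.
Qed.

Lemma runs_emitw t w0 w s : s t = written w0 ->
  runs (emitw t w) s (upd s t (written (w0 ++ w))) (size w).+1.
Proof.
elim: w w0 s => [|b w IH] w0 s e /=.
  by rewrite cats0 upd_same //; apply: runs_skip.
apply: runs_put_seq; rewrite e written_rcons -cat_rcons.
by have := IH (rcons w0 b) _ (updE s t _); rewrite upd_upd.
Qed.

Arguments emitw : simpl never.

Definition marks n : seq sym := nseq n bar.

Lemma marksS n l : marks n ++ bar :: l = bar :: marks n ++ l.
Proof. by elim: n => //= n ->. Qed.

Lemma rev_marks n : rev (marks n) = marks n.
Proof. by elim: n => //= n IH; rewrite rev_cons IH -cats1 marksS cats0. Qed.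

Lemma all_marks n : all (pred1 bar) (marks n).
Proof. by rewrite all_pred1_nseq. Qed.

Definition target (k : bool) : tape_name := if k then Fam else Out.

(* [x] is the content of the target tape, [y] that of the other output tape. *)
Definition mkt k i t c x y : store := if k then mk i t c x y else mk i t c y x.

Lemma mktE k i t c x y :
  (mkt k i t c x y In = i) * (mkt k i t c x y Tab = t) *
  (mkt k i t c x y Cnt = c) * (mkt k i t c x y (target k) = x).
Proof. by case: k. Qed.

Lemma upd_mkt k i t c x y z :
  (upd (mkt k i t c x y) In z = mkt k z t c x y) *
  (upd (mkt k i t c x y) Tab z = mkt k i z c x y) *
  (upd (mkt k i t c x y) Cnt z = mkt k i t z x y) *
  (upd (mkt k i t c x y) (target k) z = mkt k i t c z y).
Proof. by case: k; do 3?split; apply/funext => -[]. Qed.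

Definition ten : word := [:: true; false].

Lemma runs_tens_Cnt k i t l n r w y : head None r != bar ->
  runs (While (on Cnt (pred1 bar)) (Seq (emitw (target k) ten) (move Cnt GoRight)))
    (mkt k i t (zip2 l (marks n ++ r)) (written w) y)
    (mkt k i t (zip2 (marks n ++ l) r) (written (w ++ tens n)) y)
    (5 * n + 1).
Proof.
move=> hr; elim: n l w => [|n IH] l w /=.
  by rewrite cats0; apply: runs_while0; rewrite /on /reads mktE aread_zip2.
rewrite -(marksS n l) (catA w ten).
set s0 := mkt _ _ _ _ _ _.
have b1 := @runs_emitw (target k) w ten s0 (mktE _ _ _ _ _ _).2.
rewrite upd_mkt in b1.
have b2 := runs_put Cnt None GoRight (mkt k i t (zip2 l (bar :: marks n ++ r)) (written (w ++ ten)) y).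
rewrite mktE upd_mkt awriteN amoveR in b2.
apply: runs_le (runs_whileS _ (runs_seq b1 b2) (IH _ _)); first by rewrite /=; lia.
by rewrite /on /reads /s0 mktE aread_zip2.
Qed.

Lemma runs_tens_Tab k i l n r c w y : head None r != bar ->
  runs (While (on Tab (pred1 bar)) (Seq (emitw (target k) ten) (move Tab GoRight)))
    (mkt k i (zip2 l (marks n ++ r)) c (written w) y)
    (mkt k i (zip2 (marks n ++ l) r) c (written (w ++ tens n)) y)
    (5 * n + 1).
Proof.
move=> hr; elim: n l w => [|n IH] l w /=.
  by rewrite cats0; apply: runs_while0; rewrite /on /reads mktE aread_zip2.
rewrite -(marksS n l) (catA w ten).
set s0 := mkt _ _ _ _ _ _.
have b1 := @runs_emitw (target k) w ten s0 (mktE _ _ _ _ _ _).2.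
rewrite upd_mkt in b1.
have b2 := runs_put Tab None GoRight (mkt k i (zip2 l (bar :: marks n ++ r)) c (written (w ++ ten)) y).
rewrite mktE upd_mkt awriteN amoveR in b2.
apply: runs_le (runs_whileS _ (runs_seq b1 b2) (IH _ _)); first by rewrite /=; lia.
by rewrite /on /reads /s0 mktE aread_zip2.
Qed.

(** Moving both heads in step subtracts in unary: what remains to the right on [Cnt] is the
    difference of the two exponents. *)
Lemma runs_tens_both k i l n r l' r' w y : head None r != bar ->
  runs (While (on Tab (pred1 bar))
      (Seq (emitw (target k) ten) (Seq (move Tab GoRight) (move Cnt GoRight))))
    (mkt k i (zip2 l (marks n ++ r)) (zip2 l' (marks n ++ r')) (written w) y)
    (mkt k i (zip2 (marks n ++ l) r) (zip2 (marks n ++ l') r')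
      (written (w ++ tens n)) y)
    (6 * n + 1).
Proof.
move=> hr; elim: n l l' w => [|n IH] l l' w /=.
  by rewrite cats0; apply: runs_while0; rewrite /on /reads mktE aread_zip2.
rewrite -(marksS n l) -(marksS n l') (catA w ten).
set s0 := mkt _ _ _ _ _ _.
have b1 := @runs_emitw (target k) w ten s0 (mktE _ _ _ _ _ _).2.
rewrite upd_mkt in b1.
have b2 := runs_put Tab None GoRight (mkt k i (zip2 l (bar :: marks n ++ r))
  (zip2 l' (bar :: marks n ++ r')) (written (w ++ ten)) y).
rewrite mktE upd_mkt awriteN amoveR in b2.
have b3 := runs_put Cnt None GoRight (mkt k i (zip2 (bar :: l) (marks n ++ r))
  (zip2 l' (bar :: marks n ++ r')) (written (w ++ ten)) y).
rewrite mktE upd_mkt awriteN amoveR in b3.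
apply: runs_le (runs_whileS _ (runs_seq b1 (runs_seq b2 b3)) (IH _ _ _)).
  by rewrite /=; lia.
by rewrite /on /reads /s0 mktE aread_zip2.
Qed.

(** The pieces of which codes of attributes consist: fixed bits, and runs of zeros whose number
    stands in unary on a tape. Each piece leaves the heads on [Cnt] and [Tab] where it found them,
    so that pieces can be chained. *)
Variant item := Lit of word | CntTens | TabTens | BothTens.

Definition item_prog t (x : item) : prog :=
  match x with
  | Lit w => emitw t w
  | CntTens =>
      Seq (rewind Cnt (pred1 bar))
        (While (on Cnt (pred1 bar)) (Seq (emitw t ten) (move Cnt GoRight)))
  | TabTens =>
      Seq (move Tab GoRight)
        (Seq (While (on Tab (pred1 bar)) (Seq (emitw t ten) (move Tab GoRight)))
           (back Tab (pred1 bar)))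
  | BothTens =>
      Seq (rewind Cnt (pred1 bar))
        (Seq (move Tab GoRight)
          (Seq (While (on Tab (pred1 bar))
                 (Seq (emitw t ten) (Seq (move Tab GoRight) (move Cnt GoRight))))
            (Seq (emitw t [:: true; true])
              (Seq (move Cnt GoRight)
                (Seq (While (on Cnt (pred1 bar))
                       (Seq (emitw t ten) (move Cnt GoRight)))
                  (back Tab (pred1 bar)))))))
  end.

(* [T] is the length of the counter and [a] that of the marks of the table
   entry under the head. *)
Definition item_word (T a : nat) (x : item) : word :=
  match x with
  | Lit w => w
  | CntTens => tens T
  | TabTens => tens a
  | BothTens => tens a ++ [:: true; true] ++ tens (T - a.+1)
  end.

Definition needs_table (x : item) : bool :=
  match x with Lit _ | CntTens => false | _ => true end.

Definition at_entry (T a : nat) (t : atape) : Prop :=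
  exists l r, [/\ t = zip2 l (semi :: marks a ++ r), head None r != bar & a < T].

Definition item_size (x : item) : nat :=
  30 + (if x is Lit w then size w else 0).

Definition counter T : atape := zip2 (marks T) [::].

Lemma runs_rewind_Cnt k i t T x y :
  runs (rewind Cnt (pred1 bar)) (mkt k i t (counter T) x y)
    (mkt k i t (zip2 [::] (marks T)) x y) (2 * T + 3).
Proof.
have := @runs_rewind Cnt (pred1 bar) (mkt k i t (counter T) x y) (marks T) [::] [::].
rewrite mktE upd_mkt !cats0 rev_marks size_nseq; apply=> //.
exact: all_marks.
Qed.

Lemma runs_item k x i t T a w y :
  (needs_table x -> at_entry T a t) ->
  runs (item_prog (target k) x) (mkt k i t (counter T) (written w) y)
    (mkt k i t (counter T) (written (w ++ item_word T a x)) y)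
    (item_size x * T.+1).
Proof.
case: x => [v||/(_ isT)|/(_ isT)].
- move=> _; set s0 := mkt _ _ _ _ _ _.
  have := @runs_emitw (target k) w v s0 (mktE _ _ _ _ _ _).2.
  by rewrite upd_mkt; apply: runs_le; rewrite /item_size; nia.
- move=> _; have h := @runs_tens_Cnt k i t [::] T [::] w y isT.
  rewrite !cats0 in h.
  by apply: runs_le (runs_seq (runs_rewind_Cnt _ _ _ _ _ _) h); rewrite /item_size; lia.
- move=> [l [r [-> hr aT]]] /=.
  refine (runs_le _ _); last first.
    apply: runs_put_seq; rewrite mktE upd_mkt awriteN amoveR.
    apply: runs_seq (runs_tens_Tab _ _ _ _ _ _ _ hr) _.
    have := @runs_back Tab (pred1 bar) (mkt k i (zip2 (marks a ++ semi :: l) r)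
       (counter T) (written (w ++ tens a)) y) (marks a) (semi :: l) r.
    by rewrite mktE upd_mkt /= rev_marks => /(_ erefl (all_marks a) isT); exact.
  by rewrite size_nseq /item_size; lia.
move=> [l [r [-> hr aT]]] /=.
refine (runs_le _ _); last first.
  apply: runs_seq (runs_rewind_Cnt _ _ _ _ _ _) _.
  apply: runs_put_seq; rewrite mktE upd_mkt awriteN amoveR.
  (* The first [a] marks are matched with the table entry, the next one stands for the binary one at
     exponent [a], and the rest yields the zeros up to [T]. *)
  have -> : marks T = marks a ++ bar :: marks (T - a.+1).
    by rewrite -[bar :: _]/(marks (T - a.+1).+1) /marks -nseqD; congr nseq; lia.
  apply: runs_seq (runs_tens_both _ _ _ _ _ _ _ _ hr) _.
  apply: runs_seq.
    by apply: (@runs_emitw _ (w ++ tens a) [:: true; true]); rewrite mktE.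
  rewrite upd_mkt; apply: runs_put_seq; rewrite mktE upd_mkt awriteN amoveR.
  rewrite -(cats0 (marks (T - _))); apply: runs_seq (runs_tens_Cnt _ _ _ _ _ _ _ (isT : head None [::] != bar)) _.
  have := @runs_back Tab (pred1 bar) (mkt k i (zip2 (marks a ++ semi :: l) r)
     (zip2 (marks (T - a.+1) ++ bar :: marks a ++ [::]) [::])
     (written (((w ++ tens a) ++ [:: true; true]) ++ tens (T - a.+1))) y)
     (marks a) (semi :: l) r.
  rewrite mktE upd_mkt /= rev_marks => /(_ erefl (all_marks a) isT).
  have -> : zip2 (marks (T - a.+1) ++ bar :: marks a ++ [::]) [::] = counter T.
    congr zip2; rewrite cats0 -[bar :: _]/(marks a.+1) /marks -nseqD; congr nseq; lia.
  by rewrite -!catA; exact.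
by rewrite size_nseq /item_size /=; lia.
Qed.

Fixpoint items_prog t (s : seq item) : prog :=
  if s is x :: s then Seq (item_prog t x) (items_prog t s) else skip.

Definition items_word T a s : word := flatten [seq item_word T a x | x <- s].

Definition items_size s : nat := (sumn [seq item_size x | x <- s]).+1.

Lemma runs_items k s i t T a w y :
  (has needs_table s -> at_entry T a t) ->
  runs (items_prog (target k) s) (mkt k i t (counter T) (written w) y)
    (mkt k i t (counter T) (written (w ++ items_word T a s)) y)
    (items_size s * T.+1).
Proof.
elim: s w => [|x s IH] w hs.
  by rewrite /= cats0; apply: runs_le (runs_skip _); rewrite /items_size /=; lia.
rewrite /items_word /= catA; refine (runs_le _ _); last first.
  apply: runs_seq (@runs_item _ _ _ _ _ _ _ _ _) (IH _ _).
    by move=> hx; apply: hs; rewrite /= hx.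
  by move=> h; apply: hs; rewrite /= h orbT.
by rewrite /items_size /=; lia.
Qed.

(** * The reduction *)

Definition opposite (l : literal) : literal := (~~ l.1, l.2).

Definition enc_lit : literal -> word := enc_pair enc_bool enc_nat.

(* Attributes as seen from the slot of exponent [T], [a] being the exponent of
   an earlier slot: [Here k] has index 2^(T+k), [Old] 2^a and [Both] 2^a+2^T. *)
Variant attr := Here of nat | Old | Both.

Definition attr_index (T a : nat) (x : attr) : nat :=
  match x with
  | Here k => 2 ^ (T + k)
  | Old => 2 ^ a
  | Both => 2 ^ a + 2 ^ T
  end.

Fixpoint bools (n : nat) : seq (seq bool) :=
  if n is m.+1 then map (cons true) (bools m) ++ map (cons false) (bools m)
  else [:: [::]].

(** The probability under [n] independent fair bits, found by enumeration. It is taken only at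
    constant sets, so the machine writes these rationals as fixed words. *)
Definition frequency (n : nat) (A : Type) (value : seq bool -> A -> bool)
    (s : seq A) : rat :=
  ((count (fun b => all (value b) s) (bools n))%:R / (2 ^ n)%:R)%R.

(* The seven attributes of a clause as functions of its selection bits: the
   bits, each followed by its negation, and their disjunction. *)
Definition clause_bit (b : seq bool) (k : nat) : bool :=
  match k with
  | 0 | 2 | 4 => nth false b k./2
  | 1 | 3 | 5 => ~~ nth false b k./2
  | _ => [|| nth false b 0, nth false b 1 | nth false b 2]
  end.

(** The nonempty subsets of {0,1}, {2,3}, {4,5} and {1,3,5,6}. The three pairs force the negations,
    the quadruple forces attribute 6 to be the negation of the conjunction of 1, 3 and 5. *)
Definition clause_sets : seq (seq nat) :=
  [:: [:: 0]; [:: 2]; [:: 4]; [:: 0; 1]; [:: 2; 3]; [:: 4; 5];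
      [:: 1]; [:: 3]; [:: 5]; [:: 6];
      [:: 1; 3]; [:: 1; 5]; [:: 1; 6]; [:: 3; 5]; [:: 3; 6]; [:: 5; 6];
      [:: 1; 3; 5]; [:: 1; 3; 6]; [:: 1; 5; 6]; [:: 3; 5; 6];
      [:: 1; 3; 5; 6]].

Definition clause_family : seq (seq attr * rat) :=
  [seq ([seq Here k | k <- s], frequency 3 clause_bit s) | s <- clause_sets].

Definition conflict_bit (b : seq bool) (x : attr) : bool :=
  match x with
  | Old => nth false b 0
  | Here _ => nth false b 1
  | Both => ~~ (nth false b 0 && nth false b 1)
  end.

(** The nonempty subsets of the triple, except the singletons of the two slots: these are listed
    with their clauses, and no itemset may be listed twice. *)
Definition conflict_sets : seq (seq attr) :=
  [:: [:: Old; Here 0]; [:: Both]; [:: Old; Both]; [:: Here 0; Both];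
      [:: Old; Here 0; Both]].

Definition conflict_family : seq (seq attr * rat) :=
  [seq (s, frequency 2 conflict_bit s) | s <- conflict_sets].

Definition instance (T a : nat) (e : seq attr * rat) : seq nat * rat :=
  ([seq attr_index T a x | x <- e.1], e.2).

(* Clause [j] owns the exponents [7 * j + k], [k < 7]: its [i]-th literal has
   its slot at [k = 2 * i] and the negation of that slot at [k = 2 * i + 1];
   [k = 6] is the disjunction of the three slots. *)
Definition literal_at (phi : cnf) (t : nat) : option literal :=
  if t %% 7 \in [:: 0; 2; 4] then onth (nth [::] phi (t %/ 7)) (t %% 7)./2
  else None.

Definition table (phi : cnf) (T : nat) : seq (literal * nat) :=
  pmap (fun t => omap (fun l => (l, t)) (literal_at phi t)) (iota 0 T).

Definition opposed (tb : seq (literal * nat)) (l : literal) : seq nat :=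
  [seq e.2 | e <- tb & e.1 == opposite l].

Definition conflicts (phi : cnf) (t : nat) : seq nat :=
  if literal_at phi t is Some l then opposed (table phi t) l else [::].

Definition family_of (T : nat) (s : seq nat) : seq (seq nat * rat) :=
  flatten [seq map (instance T a) conflict_family | a <- s].

Definition family_at (phi : cnf) (t : nat) : seq (seq nat * rat) :=
  (if t %% 7 == 0 then map (instance t 0) clause_family else [::]) ++
  family_of t (conflicts phi t).

(** The queried indices with leading exponent [t]. An odd offset belongs to the negation of the slot
    just before it, hence [t.-1]. *)
Definition query_at (phi : cnf) (t : nat) : seq nat :=
  if t %% 7 == 6 then [:: 2 ^ t]
  else if odd (t %% 7) then
    if literal_at phi t.-1 is None then [:: 2 ^ t] else [::]
  else [seq 2 ^ a + 2 ^ t | a <- conflicts phi t].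

(** Antimonotonicity brings in the empty itemset, whose frequency is 1. *)
Definition marginals (phi : cnf) : seq (seq nat * rat) :=
  ([::], 1%R) :: flatten [seq family_at phi t | t <- iota 0 (7 * size phi)].

Definition queried (phi : cnf) : seq nat :=
  flatten [seq query_at phi t | t <- iota 0 (7 * size phi)].

(** A list code without its final [false], so that the program can extend it piece by piece. *)
Definition family_word (s : seq (seq nat * rat)) : word :=
  flatten [seq true :: enc_list enc_nat e.1 ++ enc_rat e.2 | e <- s].

Definition query_word (s : seq nat) : word :=
  flatten [seq true :: enc_nat k | k <- s].

Lemma family_word_cat s s' :
  family_word (s ++ s') = family_word s ++ family_word s'.
Proof. by rewrite /family_word map_cat flatten_cat. Qed.

Lemma query_word_cat s s' : query_word (s ++ s') = query_word s ++ query_word s'.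
Proof. by rewrite /query_word map_cat flatten_cat. Qed.

Definition attr_items (x : attr) : seq item :=
  match x with
  | Here k => [:: CntTens; Lit (tens k ++ [:: true; true; false])]
  | Old => [:: TabTens; Lit [:: true; true; false]]
  | Both => [:: BothTens; Lit [:: true; true; false]]
  end.

Definition query_items (x : attr) : seq item := Lit [:: true] :: attr_items x.

Definition entry_items (e : seq attr * rat) : seq item :=
  Lit [:: true] :: flatten [seq query_items x | x <- e.1] ++
  [:: Lit (false :: enc_rat e.2)].

Definition family_items (s : seq (seq attr * rat)) : seq item :=
  flatten [seq entry_items e | e <- s].

Lemma items_word_cat T a s s' :
  items_word T a (s ++ s') = items_word T a s ++ items_word T a s'.
Proof. by rewrite /items_word map_cat flatten_cat. Qed.

Lemma query_items_word T a x : (has needs_table (query_items x) -> a < T) ->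
  items_word T a (query_items x) = query_word [:: attr_index T a x].
Proof.
case: x => [k||] aT; rewrite /items_word /query_word /= !cats0.
- by rewrite enc_nat_exp tensD -!catA.
- by rewrite enc_nat_exp.
- by rewrite enc_nat_exp2 ?aT // -!catA.
Qed.

Lemma flatten_cons (A : Type) (x : seq A) s : flatten (x :: s) = x ++ flatten s.
Proof. by []. Qed.

Lemma set_items_word T a s :
  (has needs_table (flatten [seq query_items x | x <- s]) -> a < T) ->
  items_word T a (flatten [seq query_items x | x <- s]) =
  query_word [seq attr_index T a x | x <- s].
Proof.
elim: s => // x s IH; rewrite map_cons flatten_cons has_cat => aT.
rewrite items_word_cat IH; last by move=> h; apply: aT; rewrite h orbT.
rewrite query_items_word; first by rewrite -query_word_cat.
by move=> h; apply: aT; rewrite h.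
Qed.

Lemma family_items_word T a s : (has needs_table (family_items s) -> a < T) ->
  items_word T a (family_items s) = family_word (map (instance T a) s).
Proof.
elim: s => // e s IH.
have -> : family_items (e :: s) = entry_items e ++ family_items s by [].
rewrite has_cat => aT.
rewrite items_word_cat IH; last by move=> h; apply: aT; rewrite h orbT.
rewrite -[map _ (e :: s)]/([:: instance T a e] ++ _) family_word_cat.
congr (_ ++ _); rewrite /entry_items -cat1s !items_word_cat set_items_word.
  by rewrite /items_word /family_word /= !cats0 /enc_list -catA.
by move=> h; apply: aT; rewrite /entry_items /= has_cat h.
Qed.

(** The time budget of an item is generous enough to bound the length of its word as well, and so
    serves both purposes. *)
Lemma size_items_word T a s : a <= T ->
  size (items_word T a s) <= items_size s * T.+1.
Proof.
move=> aT; elim: s => // x s IH.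
rewrite -cat1s items_word_cat size_cat.
have : size (items_word T a [:: x]) <= item_size x * T.+1.
  rewrite /items_word /= cats0 /item_size.
  by case: x => [w|||] /=; rewrite ?size_cat ?size_tens /= ?size_tens; nia.
by move: IH; rewrite /items_size /=; nia.
Qed.

(** * Programs that scan the formula: table of literals, slots, clauses *)

Definition is_bit : pred sym := fun c => if c is Some (inl _) then true else false.

Definition compare_prog : prog :=
  While (fun r => is_bit (r Tab) && (r In == r Tab))
    (Seq (move In GoRight) (move Tab GoRight)).

Definition conflict_prog : prog :=
  Seq (items_prog Fam (family_items conflict_family))
    (items_prog Out (query_items Both)).

Definition pair_prog : prog :=
  Seq compare_prog
    (Seq (If (on Tab (pred1 semi)) conflict_prog
            (While (on Tab (predC1 semi)) (move Tab GoRight)))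
       (Seq (move Tab GoRight)
          (Seq (While (on Tab (pred1 bar)) (move Tab GoRight))
             (rewind In (predC1 hash))))).

Definition pairs_prog : prog := While (on Tab is_bit) pair_prog.

(* The code of the opposite literal, for detecting conflicts by equality. *)
Definition table_cells (tb : seq (literal * nat)) : seq sym :=
  flatten [seq bits (enc_lit (opposite e.1)) ++ semi :: marks e.2 | e <- tb].

Lemma upd_mk i t c f o z :
  (upd (mk i t c f o) In z = mk z t c f o) *
  (upd (mk i t c f o) Tab z = mk i z c f o) *
  (upd (mk i t c f o) Cnt z = mk i t z f o) *
  (upd (mk i t c f o) Fam z = mk i t c z o) *
  (upd (mk i t c f o) Out z = mk i t c f z).
Proof. by do 4?split; apply/funext => -[]. Qed.

(** [p] is the common part over which both heads advance; the table code is exhausted exactly when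
    it is a prefix of the input. *)
Lemma runs_compare (l tl : seq sym) (u w : word) z c f o :
  exists p u' w', [/\ u = p ++ u', w = p ++ w', nilp w' = prefix w u &
    runs compare_prog
      (mk (zip2 l (bits u)) (zip2 tl (bits w ++ semi :: z)) c f o)
      (mk (zip2 (rev (bits p) ++ l) (bits u'))
          (zip2 (rev (bits p) ++ tl) (bits w' ++ semi :: z)) c f o)
      (3 * size w + 1)].
Proof.
elim: w u l tl => [|b w IH] u l tl.
  exists [::], u, [::]; split; rewrite ?prefix0s //; apply: runs_while0.
  by rewrite /reads /= ?aread_zip2.
case: u => [|b' u].
  exists [::], [::], (b :: w); split=> //.
  apply: (@runs_le _ _ _ 1); first by rewrite addn1.
  by apply: runs_while0; rewrite /reads /= ?aread_zip2.
have [<-{b'}|bb] := eqVneq b b'; last first.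
  exists [::], (b' :: u), (b :: w); split=> //.
    by rewrite /= (negbTE bb).
  apply: (@runs_le _ _ _ 1); first by rewrite addn1.
  by apply: runs_while0; rewrite /reads /= ?aread_zip2 /=; apply: contraNneq bb => -[->].
have [p [u' [w' [-> -> e h]]]] := IH u (bit b :: l) (bit b :: tl).
exists (b :: p), u', w'; split=> //.
  by rewrite /= eqxx -e.
rewrite /= !rev_cons !cat_rcons.
have b1 := runs_put In None GoRight (mk (zip2 l (bits (b :: p ++ u')))
  (zip2 tl (bits (b :: p ++ w') ++ semi :: z)) c f o).
rewrite upd_mk awriteN /= amoveR in b1.
have b2 := runs_put Tab None GoRight (mk (zip2 (bit b :: l) (bits (p ++ u')))
  (zip2 tl (bits (b :: p ++ w') ++ semi :: z)) c f o).
rewrite upd_mk awriteN /= amoveR in b2.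
apply: runs_le (runs_whileS _ (runs_seq b1 b2) h) => /=; first lia.
by rewrite /reads /= ?aread_zip2 /= eqxx.
Qed.

Lemma oppositeK : involutive opposite.
Proof. by case=> b n; rewrite /opposite negbK. Qed.

Arguments enc_lit : simpl never.

Lemma enc_litP : prefix_code enc_lit.
Proof. exact: enc_pairP enc_boolP enc_natP. Qed.

(** Literal codes form a prefix code, so the comparison need not detect where the literal in the
    input ends. *)
Lemma prefix_lit l l' w : prefix (enc_lit l') (enc_lit l ++ w) = (l' == l).
Proof.
apply/idP/eqP => [/prefixP[w' /enc_litP[-> //]]|->]; exact: prefix_prefix.
Qed.

Lemma runs_items_mk k s i t T a f o :
  (has needs_table s -> at_entry T a t) ->
  runs (items_prog (target k) s) (mk i t (counter T) (written f) (written o))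
    (mk i t (counter T)
      (written (if k then f ++ items_word T a s else f))
      (written (if k then o else o ++ items_word T a s)))
    (items_size s * T.+1).
Proof.
move=> h; case: k; first exact: (@runs_items true s i t T a f (written o) h).
exact: (@runs_items false s i t T a o (written f) h).
Qed.

Definition conflict_cost : nat :=
  items_size (family_items conflict_family) + items_size (query_items Both).

Lemma at_entry_lt T a t : at_entry T a t -> a < T.
Proof. by case=> l [r []]. Qed.

Lemma runs_conflict i t T a f o : at_entry T a t ->
  runs conflict_prog (mk i t (counter T) (written f) (written o))
    (mk i t (counter T) (written (f ++ family_word (family_of T [:: a])))
      (written (o ++ query_word [:: 2 ^ a + 2 ^ T])))
    (conflict_cost * T.+1).
Proof.
move=> ta; have aT := at_entry_lt ta; rewrite mulnDl.
have h1 := @runs_items_mk true (family_items conflict_family) i t T a f o (fun _ => ta).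
rewrite family_items_word // in h1.
have h2 := @runs_items_mk false (query_items Both) i t T a
  (f ++ family_word (map (instance T a) conflict_family)) o (fun _ => ta).
rewrite query_items_word // in h2.
have -> : family_of T [:: a] = map (instance T a) conflict_family.
  exact: cats0.
by apply: runs_seq h1 h2.
Qed.

Definition entry_cells (e : literal * nat) : seq sym :=
  bits (enc_lit (opposite e.1)) ++ semi :: marks e.2.

Lemma table_cells_cons e tb :
  table_cells (e :: tb) = entry_cells e ++ table_cells tb.
Proof. by []. Qed.

Lemma table_cells_cat tb tb' :
  table_cells (tb ++ tb') = table_cells tb ++ table_cells tb'.
Proof. by rewrite /table_cells map_cat flatten_cat. Qed.

Lemma head_table_cells tb : head None (table_cells tb) != bar.
Proof. by case: tb. Qed.

Definition pair_cost : nat := conflict_cost + 20.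

Lemma all_bits_pred (c : pred sym) w : (forall b, c (bit b)) -> all c (bits w).
Proof. by move=> h; elim: w => //= b w ->; rewrite h. Qed.

Lemma runs_pair l lit w tl e tr T f o : e.2 < T -> head None tr != bar ->
  let s := if e.1 == opposite lit then [:: e.2] else [::] in
  runs pair_prog
    (mk (zip2 (hash :: l) (bits (enc_lit lit ++ w)))
       (zip2 tl (entry_cells e ++ tr)) (counter T) (written f) (written o))
    (mk (zip2 (hash :: l) (bits (enc_lit lit ++ w)))
       (zip2 (rev (entry_cells e) ++ tl) tr) (counter T)
       (written (f ++ family_word (family_of T s)))
       (written (o ++ query_word [seq 2 ^ a + 2 ^ T | a <- s])))
    (pair_cost * (T + size (enc_lit e.1)).+1).
Proof.
case: e => l' a; rewrite [(l', a).1]/= [(l', a).2]/= => aT hr s.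
have -> : entry_cells (l', a) ++ tr =
    bits (enc_lit (opposite l')) ++ semi :: marks a ++ tr.
  by rewrite /entry_cells -catA.
set u := enc_lit lit ++ w; set v := enc_lit (opposite l').
have sv : size v = size (enc_lit l') by [].
have [p [u' [v' [eu ev pv h1]]]] := runs_compare (hash :: l) tl u v
  (marks a ++ tr) (counter T) (written f) (written o).
have {pv}pv : nilp v' = (l' == opposite lit).
  by rewrite pv prefix_lit (can2_eq oppositeK oppositeK).
have -> : entry_cells (l', a) = bits v ++ semi :: marks a by [].
clearbody u v.
(* Both branches of the test end with the table head on the [semi] of this entry: writing a conflict
   restores the head, and a mismatch skips the rest of the code. *)
set s2 := mk (zip2 (rev (bits p) ++ hash :: l) (bits u'))
  (zip2 (rev (bits v) ++ tl) (semi :: marks a ++ tr)) (counter T)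
  (written (f ++ family_word (family_of T s)))
  (written (o ++ query_word [seq 2 ^ a + 2 ^ T | a <- s])).
have h2 : runs (If (on Tab (pred1 semi)) conflict_prog
            (While (on Tab (predC1 semi)) (move Tab GoRight)))
    (mk (zip2 (rev (bits p) ++ hash :: l) (bits u'))
      (zip2 (rev (bits p) ++ tl) (bits v' ++ semi :: marks a ++ tr))
      (counter T) (written f) (written o)) s2
    (conflict_cost * T.+1 + 2 * size v + 2).
  apply: (@runs_le _ _ _ (conflict_cost * T.+1 + 2 * size v + 1).+1).
    by lia.
  apply: runs_if; rewrite /on /reads [mk _ _ _ _ _ Tab]/=.
  rewrite /s2 /s -pv; case: v' ev {pv h1} => [|b v'] ev /=.
    rewrite ev cats0.
    apply: (@runs_le _ _ _ (conflict_cost * T.+1)); first by lia.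
    by apply: runs_conflict; exists (rev (bits p) ++ tl), tr.
  rewrite [family_word _]/= [query_word _]/= !cats0.
  apply: (@runs_le _ _ _ (2 * size (bits (b :: v')) + 1)).
    by rewrite size_map ev size_cat /=; lia.
  have := @runs_scan Tab (predC1 semi) (mk (zip2 (rev (bits p) ++ hash :: l) (bits u'))
      (zip2 (rev (bits p) ++ tl) (bits (b :: v') ++ semi :: marks a ++ tr))
      (counter T) (written f) (written o)) _ _ _ erefl.
  rewrite upd_mk ev bits_cat rev_cat -catA; apply=> //.
  exact: all_bits_pred.
have h3 := runs_put Tab None GoRight s2.
rewrite /s2 upd_mk awriteN /= amoveR in h3.
have h4 := @runs_scan Tab (pred1 bar) (mk (zip2 (rev (bits p) ++ hash :: l) (bits u'))
  (zip2 (semi :: rev (bits v) ++ tl) (marks a ++ tr)) (counter T)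
  (written (f ++ family_word (family_of T s)))
  (written (o ++ query_word [seq 2 ^ a + 2 ^ T | a <- s]))) _ _ _ erefl
  (all_marks a) hr.
rewrite upd_mk size_nseq in h4.
have h5 := @runs_rewind In (predC1 hash) (mk (zip2 (rev (bits p) ++ hash :: l) (bits u'))
  (zip2 (rev (marks a) ++ semi :: rev (bits v) ++ tl) tr) (counter T)
  (written (f ++ family_word (family_of T s)))
  (written (o ++ query_word [seq 2 ^ a + 2 ^ T | a <- s]))) _ _ _ erefl.
have {}h5 := h5 _ isT; rewrite all_rev all_bits_pred // in h5.
have {}h5 := h5 erefl; rewrite upd_mk revK -bits_cat -eu size_rev size_map in h5.
have sp : size p <= size v by rewrite ev size_cat leq_addr.
rewrite rev_cat rev_cons cat_rcons -catA.
apply: runs_le (runs_seq h1 (runs_seq h2 (runs_seq h3 (runs_seq h4 h5)))).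
by rewrite -sv /pair_cost; move: conflict_cost => cc; nia.
Qed.

Definition pairs_cost T L n : nat := n * (pair_cost * (T + L).+1).+1 + 1.

Lemma runs_pairs L l lit w tl tb T f o :
  all (fun e : literal * nat => (e.2 < T) && (size (enc_lit e.1) <= L)) tb ->
  runs pairs_prog
    (mk (zip2 (hash :: l) (bits (enc_lit lit ++ w)))
       (zip2 tl (table_cells tb)) (counter T) (written f) (written o))
    (mk (zip2 (hash :: l) (bits (enc_lit lit ++ w)))
       (zip2 (rev (table_cells tb) ++ tl) [::]) (counter T)
       (written (f ++ family_word (family_of T (opposed tb lit))))
       (written (o ++ query_word [seq 2 ^ a + 2 ^ T | a <- opposed tb lit])))
    (pairs_cost T L (size tb)).
Proof.
elim: tb tl f o => [|e tb IH] tl f o.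
  rewrite /opposed /= !cats0 => _; apply: runs_while0.
  by rewrite /on /reads /= ?aread_zip2.
rewrite [all _ _]/= => /andP[/andP[eT eL] htb].
have h := @runs_pair l lit w tl e (table_cells tb) T f o eT (head_table_cells tb).
have := runs_whileS _ h (IH _ _ _ htb); rewrite table_cells_cons rev_cat -catA.
have -> : opposed (e :: tb) lit =
    (if e.1 == opposite lit then [:: e.2] else [::]) ++ opposed tb lit.
  by rewrite /opposed /=; case: eqP.
rewrite map_cat query_word_cat -!catA.
rewrite {3}/family_of map_cat flatten_cat family_word_cat => h'.
apply: runs_le (h' _).
  have : pair_cost * (T + size (enc_lit e.1)).+1 <= pair_cost * (T + L).+1.
    by rewrite leq_mul2l ltnS leq_add2l eL orbT.
  rewrite /pairs_cost -[size (e :: tb)]/(size tb).+1 mulSn.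
  move: (pair_cost * _) (pair_cost * (T + L).+1) (size tb * _) => A B X; lia.
by rewrite /on /reads /= ?aread_zip2.
Qed.

Definition copy_bit_prog : prog :=
  If (on In (pred1 (bit true))) (emit Tab true) (emit Tab false).

Definition copy_prog : prog :=
  While (on In (pred1 (bit true)))
    (Seq (emit Tab true)
      (Seq (move In GoRight) (Seq copy_bit_prog (move In GoRight)))).

Definition copy_marks_prog : prog :=
  While (on Cnt (pred1 bar)) (Seq (Put Tab (Some bar) GoRight) (move Cnt GoRight)).

(** The sign is negated and the digits are copied unchanged, which yields the code of the opposite
    literal; the exponent is copied from the counter. *)
Definition append_prog : prog :=
  Seq (If (on In (pred1 (bit true))) (emit Tab false) (emit Tab true))
    (Seq (move In GoRight)
      (Seq copy_prog
        (Seq (emit Tab false)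
          (Seq (move In GoRight)
            (Seq (Put Tab (Some semi) GoRight)
              (Seq (rewind Cnt (pred1 bar))
                (Seq copy_marks_prog (rewind Tab (predC1 None))))))))).

Definition pairs_of_bits (ds : seq bool) : word :=
  flatten [seq true :: enc_bool b | b <- ds].

Lemma runs_If_eq c p q (b : bool) s s' n :
  c (reads s) = b -> runs (if b then p else q) s s' n ->
  runs (If c p q) s s' n.+1.
Proof. by move=> <-; apply: runs_if. Qed.

Lemma runs_copy l tl ds w c f o :
  runs copy_prog
    (mk (zip2 l (bits (enc_list enc_bool ds ++ w))) (zip2 tl [::]) c f o)
    (mk (zip2 (rev (bits (pairs_of_bits ds)) ++ l) (bits (false :: w)))
      (zip2 (rev (bits (pairs_of_bits ds)) ++ tl) [::]) c f o)
    (6 * size ds + 1).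
Proof.
elim: ds l tl => [|b ds IH] l tl.
  by apply: runs_while0; rewrite /on /reads /= ?aread_zip2.
set s0 := mk _ _ _ _ _.
have h : runs (Seq (emit Tab true)
      (Seq (move In GoRight) (Seq copy_bit_prog (move In GoRight)))) s0
    (mk (zip2 [:: bit b, bit true & l] (bits (enc_list enc_bool ds ++ w)))
       (zip2 [:: bit b, bit true & tl] [::]) c f o) 5.
  rewrite /s0; apply: runs_put_seq; rewrite upd_mk /= awrite0 amoveR.
  apply: runs_put_seq; rewrite upd_mk /= awriteN amoveR.
  apply: (@runs_seq _ _ _ _ _ 2 1).
    apply: (@runs_If_eq _ _ _ b); first by rewrite /on /reads /= ?aread_zip2; case: (b).
    rewrite (_ : (if b then _ else _) = emit Tab b); last by case: (b).
    exact: runs_put.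
  rewrite upd_mk /= awrite0 amoveR.
  have := runs_put In None GoRight (mk (zip2 (bit true :: l)
    (bits (b :: enc_list enc_bool ds ++ w))) (zip2 [:: bit b, bit true & tl] [::]) c f o).
  by rewrite upd_mk /= awriteN amoveR.
have := runs_whileS _ h (IH _ _).
rewrite /pairs_of_bits /= !rev_cons !cat_rcons => h'.
apply: runs_le (h' _); first by lia.
by rewrite /on /reads /= ?aread_zip2.
Qed.

Lemma runs_copy_marks i tl l n f o :
  runs copy_marks_prog (mk i (zip2 tl [::]) (zip2 l (marks n)) f o)
    (mk i (zip2 (marks n ++ tl) [::]) (zip2 (marks n ++ l) [::]) f o)
    (3 * n + 1).
Proof.
elim: n l tl => [|n IH] l tl.
  by apply: runs_while0; rewrite /on /reads /= ?aread_zip2.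
set s0 := mk _ _ _ _ _.
have h : runs (Seq (Put Tab (Some bar) GoRight) (move Cnt GoRight)) s0
    (mk i (zip2 (bar :: tl) [::]) (zip2 (bar :: l) (marks n)) f o) 2.
  rewrite /s0; apply: runs_put_seq; rewrite upd_mk /= awrite0 amoveR.
  have := runs_put Cnt None GoRight (mk i (zip2 (bar :: tl) [::])
     (zip2 l (bar :: marks n)) f o).
  by rewrite upd_mk /= awriteN amoveR.
have := runs_whileS _ h (IH _ _); rewrite !marksS => h'.
apply: runs_le (h' _); first by lia.
by rewrite /on /reads /= ?aread_zip2.
Qed.

Lemma table_cells_neq_None tb : all (predC1 None) (table_cells tb).
Proof.
elim: tb => // e tb IH; rewrite table_cells_cons all_cat IH andbT.
rewrite /entry_cells all_cat all_bits_pred //=.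
by elim: e.2.
Qed.

Lemma size_opposite l : size (enc_lit (opposite l)) = size (enc_lit l).
Proof. by []. Qed.

Lemma size_table_cells T L tb :
  all (fun e : literal * nat => (e.2 < T) && (size (enc_lit e.1) <= L)) tb ->
  size (table_cells tb) <= size tb * (T + L).
Proof.
elim: tb => // e tb IH; rewrite [all _ _]/= => /andP[/andP[eT eL] /IH h].
rewrite table_cells_cons size_cat /entry_cells size_cat size_map size_opposite.
rewrite -[size (_ :: marks _)]/(size (marks e.2)).+1 size_nseq mulSn.
by apply: leq_add => //; rewrite addnC; apply: leq_add.
Qed.

Lemma runs_append l lit w tb T f o :
  let tb' := rcons tb (lit, T) in
  runs append_prog
    (mk (zip2 l (bits (enc_lit lit ++ w))) (zip2 (rev (table_cells tb)) [::])
       (counter T) f o)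
    (mk (zip2 (rev (bits (enc_lit lit)) ++ l) (bits w))
       (zip2 [::] (table_cells tb')) (counter T) f o)
    (6 * size (enc_lit lit) + 5 * T + 2 * size (table_cells tb') + 20).
Proof.
case: lit => b n tb'; rewrite /enc_lit /enc_pair /=.
set ds := digits n; rewrite /enc_nat -/ds.
have sd : size ds <= size (enc_list enc_bool ds).
  by rewrite /enc_list size_cat; elim: ds => //= b' ds IH; lia.
have et : table_cells tb' = rev (marks T ++ [:: semi, bit false & rev (bits (pairs_of_bits ds)) ++ bit (~~ b) :: rev (table_cells tb)]).
  rewrite /tb' -cats1 table_cells_cat /table_cells /= cats0 /enc_lit /enc_pair /=.
  rewrite /enc_nat -/ds /enc_list bits_cat !rev_cat !rev_cons !rev_cat !rev_cons !revK rev_marks.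
  by rewrite -!cats1 /= -!catA.
refine (runs_le _ _); last first.
  apply: runs_seq.
    apply: (@runs_If_eq _ _ _ b); first by rewrite /on /reads /= ?aread_zip2; case: (b).
    rewrite (_ : (if b then _ else _) = emit Tab (~~ b)); last by case: (b).
    exact: runs_put.
  rewrite upd_mk /= awrite0 amoveR.
  apply: runs_put_seq; rewrite upd_mk /= awriteN amoveR.
  apply: runs_seq; first exact: runs_copy.
  apply: runs_put_seq; rewrite upd_mk /= awrite0 amoveR.
  apply: runs_put_seq; rewrite upd_mk /= awriteN amoveR.
  apply: runs_put_seq; rewrite upd_mk /= awrite0 amoveR.
  apply: runs_seq; first exact: (@runs_rewind_Cnt true).
  apply: runs_seq; first exact: runs_copy_marks.
  rewrite cats0; set x := marks T ++ _.
  have := @runs_rewind Tab (predC1 None) (mk (zip2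
      (bit false :: rev (bits (pairs_of_bits ds)) ++ bit b :: l) (bits w))
      (zip2 x [::]) (zip2 (marks T) [::]) f o) x [::] [::].
  rewrite !cats0 upd_mk => /(_ erefl).
  have -> : all (predC1 None) x.
    by rewrite -all_rev -et table_cells_neq_None.
  rewrite -et -(size_rev x) -et => /(_ erefl isT) h.
  rewrite {1}/enc_list bits_cat rev_cons rev_cat -!cats1 -!catA in h *.
  exact: h.
by rewrite /=; lia.
Qed.

Definition incr_prog : prog := Put Cnt (Some bar) GoRight.

(* [hash] overwrites the list marker of the current literal, so that the head
   can find its way back to the literal after each comparison. *)
Definition slot_prog : prog :=
  Seq
    (If (on In (pred1 (bit true)))
       (Seq (Put In (Some hash) GoRight) (Seq pairs_prog append_prog))
       (items_prog Out (query_items (Here 1))))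
    (Seq incr_prog incr_prog).

Definition state l w T tb f o : store :=
  mk (zip2 l (bits w)) (zip2 [::] (table_cells tb)) (counter T)
    (written (family_word f)) (written (query_word o)).

Lemma runs_incr i t T f o :
  runs incr_prog (mk i t (counter T) f o) (mk i t (counter T.+1) f o) 1.
Proof.
have := runs_put Cnt (Some bar) GoRight (mk i t (counter T) f o).
by rewrite upd_mk /= awrite0 amoveR.
Qed.

Definition slot_cost : nat := pair_cost + 50 + items_size (query_items (Here 1)).

Definition bounded T L (tb : seq (literal * nat)) : bool :=
  all (fun e : literal * nat => (e.2 < T) && (size (enc_lit e.1) <= L)) tb.

(** The table has at most [T] entries, and treating one entry costs a multiple of T + L + 1; hence
    the square. *)
Lemma runs_slot_some L l lit w T tb f o :
  bounded T L tb -> size tb <= T -> size (enc_lit lit) <= L ->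
  exists l',
    runs slot_prog (state l (true :: enc_lit lit ++ w) T tb f o)
      (state l' w T.+2 (rcons tb (lit, T)) (f ++ family_of T (opposed tb lit))
        (o ++ [seq 2 ^ a + 2 ^ T | a <- opposed tb lit]))
      (slot_cost * (T + L).+1 ^ 2).
Proof.
move=> htb stb sl; exists (rev (bits (enc_lit lit)) ++ hash :: l).
have stb' : size (table_cells (rcons tb (lit, T))) <= (T + L).+1 ^ 2.
  apply: leq_trans (@size_table_cells T.+1 L _ _) _.
    rewrite all_rcons [(_, _).2]/= [(_, _).1]/= ltnSn sl /=.
    by apply: sub_all htb => e /andP[h ->]; rewrite andbT; apply: leqW.
  by rewrite size_rcons addSn -mulnn leq_mul2r; lia.
have h1 := @runs_pairs L l lit w [::] tb T (family_word f) (query_word o) htb.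
rewrite cats0 in h1.
have h2 := @runs_append (hash :: l) lit w tb T
  (written (family_word f ++ family_word (family_of T (opposed tb lit))))
  (written (query_word o ++ query_word [seq 2 ^ a + 2 ^ T | a <- opposed tb lit])).
rewrite /state family_word_cat query_word_cat.
refine (runs_le _ _); last first.
  apply: runs_seq; last exact: runs_seq (runs_incr _ _ _ _ _) (runs_incr _ _ _ _ _).
  apply: (@runs_If_eq _ _ _ true); first by rewrite /on /reads /= ?aread_zip2.
  apply: runs_put_seq; rewrite upd_mk [mk _ _ _ _ _ In]/=.
  rewrite awriteE amoveR.
  exact: runs_seq h1 h2.
rewrite /slot_cost /pairs_cost.
move: (items_size _) pair_cost (size (table_cells _)) stb' (size (enc_lit lit)) sl
  (size tb) stb => q pc x + y + n.
rewrite -mulnn => xM yL nT; set M := (T + L).+1 in xM *.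
have nM : n * (pc * M).+1 <= M * (pc * M).+1 by rewrite leq_mul2r; lia.
have MM : M <= M * M by rewrite leq_pmulr.
have M1 : 1 <= M by [].
have qM : 0 <= q * (M * M) by [].
by rewrite !mulnDl; nia.
Qed.

(** The input head stays on the [false] that ends the clause, so all later slots of a short clause
    are found missing too. *)
Lemma runs_slot_none L l w T tb f o :
  runs slot_prog (state l (false :: w) T tb f o)
    (state l (false :: w) T.+2 tb f (o ++ [:: 2 ^ T.+1]))
    (slot_cost * (T + L).+1 ^ 2).
Proof.
rewrite /state query_word_cat.
have h := @runs_items_mk false (query_items (Here 1)) (zip2 l (bits (false :: w)))
  (zip2 [::] (table_cells tb)) T 0 (family_word f) (query_word o).
rewrite query_items_word //= addn1 in h.
refine (runs_le _ _); last first.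
  apply: runs_seq; last exact: runs_seq (runs_incr _ _ _ _ _) (runs_incr _ _ _ _ _).
  apply: (@runs_If_eq _ _ _ false); first by rewrite /on /reads /= ?aread_zip2.
  exact: h.
rewrite /slot_cost; move: (items_size _) pair_cost => q pc.
set M := (T + L).+1; have MM : M <= M * M by rewrite leq_pmulr.
have TM : q * T.+1 <= q * (M * M).
  by rewrite leq_mul2l; apply/orP; right; apply: leq_trans MM; rewrite /M; lia.
rewrite -mulnn !mulnDl; have : 1 <= M * M by [].
lia.
Qed.

Lemma literal_at_clause phi j k : k < 7 ->
  literal_at phi (7 * j + k) =
  if k \in [:: 0; 2; 4] then onth (nth [::] phi j) k./2 else None.
Proof.
move=> k7; rewrite /literal_at mulnC modnMDl (modn_small k7).
by rewrite divnMDl // (divn_small k7) addn0.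
Qed.

Lemma modn7 j k : k < 7 -> (7 * j + k) %% 7 = k.
Proof. by move=> k7; rewrite mulnC modnMDl modn_small. Qed.

Lemma tableS phi T : table phi T.+1 =
  table phi T ++ (if literal_at phi T is Some l then [:: (l, T)] else [::]).
Proof.
rewrite /table -addn1 iotaD pmap_cat /= add0n; congr (_ ++ _).
by case: literal_at.
Qed.

Lemma table_bounded phi T L :
  (forall t l, t < T -> literal_at phi t = Some l -> size (enc_lit l) <= L) ->
  bounded T L (table phi T).
Proof.
elim: T => // T IH h; rewrite tableS /bounded all_cat; apply/andP; split.
  have := IH (fun t l tT => h t l (ltnW tT)).
  by apply: sub_all => e /andP[lt_eT ->]; rewrite andbT; apply: leqW.
case e: literal_at => [l|] //=.
by rewrite ltnSn (h T l).
Qed.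

Lemma size_table phi T : size (table phi T) <= T.
Proof. by rewrite /table size_pmap -[X in _ <= X](size_iota 0 T) count_size. Qed.

Lemma enc_list_cons (A : Type) (e : A -> word) x s :
  enc_list e (x :: s) = (true :: e x) ++ enc_list e s.
Proof. by rewrite /enc_list /= catA. Qed.

Lemma runs_slot L phi l w j i f o :
  let C := nth [::] phi j in let t := 7 * j + 2 * i in
  i < 3 ->
  (forall t l, literal_at phi t = Some l -> size (enc_lit l) <= L) ->
  exists l',
    runs slot_prog
      (state l (enc_list enc_lit (drop i C) ++ w) t (table phi t) f o)
      (state l' (enc_list enc_lit (drop i.+1 C) ++ w) t.+2 (table phi t.+2)
        (f ++ family_of t (conflicts phi t))
        (o ++ query_at phi t ++ query_at phi t.+1))
      (slot_cost * (t + L).+1 ^ 2).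
Proof.
move=> C t i3 hL.
have hi : [|| i == 0, i == 1 | i == 2] by lia.
have lt : literal_at phi t = onth C i.
  rewrite literal_at_clause; last by lia.
  by case/or3P: hi => /eqP->.
have lt1 : literal_at phi t.+1 = None.
  rewrite /t -addnS literal_at_clause; last by lia.
  by case/or3P: hi => /eqP->.
have qt : query_at phi t = [seq 2 ^ a + 2 ^ t | a <- conflicts phi t].
  rewrite /query_at modn7; last by lia.
  by case/or3P: hi => /eqP->.
have qt1 : query_at phi t.+1 = if onth C i is None then [:: 2 ^ t.+1] else [::].
  rewrite /query_at (_ : t.+1 %% 7 = (2 * i).+1); last first.
    by rewrite /t -addnS modn7 //; lia.
  rewrite [t.+1.-1]/= lt {lt lt1 qt}.
  by case/or3P: hi => /eqP->.
rewrite !tableS lt lt1 cats0 qt qt1 /conflicts lt.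
case e: (onth C i) => [lit|].
  have iC : i < size C.
    by rewrite -onthTE e.
  have -> : drop i C = lit :: drop i.+1 C.
    rewrite (drop_nth lit iC); congr (_ :: _).
    exact: onth_nth e.
  have [l' h] := @runs_slot_some L l lit (enc_list enc_lit (drop i.+1 C) ++ w) t
    (table phi t) f o (table_bounded (fun t l _ => @hL t l)) (size_table _ _)
    (hL t lit (etrans lt e)).
  exists l'; move: h; rewrite !cats0 cats1.
  by rewrite enc_list_cons -catA.
have iC : size C <= i.
  by rewrite -onthNE e.
rewrite !drop_oversize ?(leqW iC) //; exists l.
rewrite -[family_of _ _]/[::] !cats0; exact: (@runs_slot_none L).
Qed.

(** Each slot advances the counter by two, so after three slots it stands at offset 6, the
    disjunction; the last increment reaches the next clause. *)
Definition clause_prog : prog :=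
  Seq (move In GoRight)
    (Seq (items_prog Fam (family_items clause_family))
      (Seq slot_prog (Seq slot_prog (Seq slot_prog
        (Seq (move In GoRight)
          (Seq (items_prog Out (query_items (Here 0))) incr_prog)))))).

Definition clause_cost : nat :=
  3 * slot_cost + items_size (family_items clause_family) +
  items_size (query_items (Here 0)) + 5.

Lemma flatten_iota7 (A : Type) (g : nat -> seq A) j :
  flatten [seq g t | t <- iota (7 * j) 7] =
  g (7 * j) ++ g (7 * j).+1 ++ g (7 * j).+2 ++ g (7 * j).+3 ++ g (7 * j).+4 ++
  g (7 * j).+4.+1 ++ g (7 * j).+4.+2.
Proof. by rewrite /= cats0. Qed.

Lemma conflicts_nil phi j k : k < 7 -> k \notin [:: 0; 2; 4] ->
  conflicts phi (7 * j + k) = [::].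
Proof. by move=> k7 hk; rewrite /conflicts literal_at_clause // (negbTE hk). Qed.

Lemma family_at_clause phi j k : k < 7 -> family_at phi (7 * j + k) =
  (if k == 0 then map (instance (7 * j + k) 0) clause_family else [::]) ++
  (if k \in [:: 0; 2; 4] then family_of (7 * j + k) (conflicts phi (7 * j + k))
   else [::]).
Proof.
move=> k7; rewrite /family_at modn7 //; congr (_ ++ _).
by case: ifPn => // hk; rewrite conflicts_nil.
Qed.

Lemma family_clause phi j : let t := 7 * j in
  flatten [seq family_at phi t | t <- iota t 7] =
  map (instance t 0) clause_family ++ family_of t (conflicts phi t) ++
  family_of t.+2 (conflicts phi t.+2) ++ family_of t.+4 (conflicts phi t.+4).
Proof.
move=> t; rewrite flatten_iota7 -/t.
have F k : k < 7 -> _ := @family_at_clause phi j k.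
have := F 0 isT; have := F 1 isT; have := F 2 isT; have := F 3 isT.
have := F 4 isT; have := F 5 isT; have := F 6 isT.
by rewrite !addnS addn0 -/t => -> -> -> -> -> -> ->;
  move: (map (instance t 0) _) => x; rewrite /= !cats0 -!catA.
Qed.

Lemma query_clause phi j : let t := 7 * j in
  flatten [seq query_at phi t | t <- iota t 7] =
  query_at phi t ++ query_at phi t.+1 ++ query_at phi t.+2 ++
  query_at phi t.+3 ++ query_at phi t.+4 ++ query_at phi t.+4.+1 ++
  [:: 2 ^ t.+4.+2].
Proof.
move=> t; rewrite flatten_iota7 -/t; do 6![congr (_ ++ _)].
by have := @modn7 j 6 isT; rewrite /query_at !addnS addn0 -/t => ->.
Qed.

Lemma runs_clause L phi l w j f o :
  let C := nth [::] phi j in let t := 7 * j in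
  size C <= 3 ->
  (forall t l, literal_at phi t = Some l -> size (enc_lit l) <= L) ->
  exists l',
    runs clause_prog
      (state l (true :: enc_list enc_lit C ++ w) t (table phi t) f o)
      (state l' w (7 * j.+1) (table phi (7 * j.+1))
        (f ++ flatten [seq family_at phi t | t <- iota t 7])
        (o ++ flatten [seq query_at phi t | t <- iota t 7]))
      (clause_cost * (7 * j.+1 + L).+1 ^ 2).
Proof.
move=> C t sC hL; rewrite family_clause query_clause -/t.
set f0 := f ++ map (instance t 0) clause_family.
have h0 := @runs_items_mk true (family_items clause_family)
  (zip2 (bit true :: l) (bits (enc_list enc_lit C ++ w)))
  (zip2 [::] (table_cells (table phi t))) t 0 (family_word f) (query_word o).
rewrite family_items_word // -family_word_cat -/f0 in h0.
(* No item of the clause family consults the table, so the exponent 0 is a dummy and the side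
   condition holds vacuously. *)
have {}h0 := h0 (fun h => False_ind _ (Bool.diff_false_true h)).
have [l1] := @runs_slot L phi (bit true :: l) w j 0 f0 o isT hL.
rewrite -/C drop0 addn0 -/t => h1.
set f1 := f0 ++ _ in h1; set o1 := o ++ _ in h1.
have [l2] := @runs_slot L phi l1 w j 1 f1 o1 isT hL.
rewrite -/C !addnS addn0 -/t => h2.
set f2 := f1 ++ _ in h2; set o2 := o1 ++ _ in h2.
have [l3] := @runs_slot L phi l2 w j 2 f2 o2 isT hL.
rewrite -/C !addnS addn0 -/t (drop_oversize sC) => h3.
set f3 := f2 ++ _ in h3; set o3 := o2 ++ _ in h3.
exists (bit false :: l3).
have e7 : 7 * j.+1 = t.+4.+3 by rewrite /t; lia.
have -> : table phi (7 * j.+1) = table phi t.+4.+2.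
  rewrite e7 tableS (_ : literal_at _ _ = None) ?cats0 //.
  by have := @literal_at_clause phi j 6 isT; rewrite !addnS addn0 -/t.
have h4 := @runs_items_mk false (query_items (Here 0))
  (zip2 (bit false :: l3) (bits w))
  (zip2 [::] (table_cells (table phi t.+4.+2))) t.+4.+2 0 (family_word f3) (query_word o3).
rewrite query_items_word //= addn0 -query_word_cat in h4.
have {}h4 := h4 (fun h => False_ind _ (Bool.diff_false_true h)).
refine (runs_le _ _); last first.
  rewrite /state; apply: runs_put_seq; rewrite upd_mk awriteN [mk _ _ _ _ _ In]/= amoveR.
  apply: (runs_seq h0); apply: (runs_seq h1); apply: (runs_seq h2).
  apply: (runs_seq h3).
  rewrite /state; apply: runs_put_seq; rewrite upd_mk awriteN [mk _ _ _ _ _ In]/= amoveR.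
  apply: (runs_seq h4).
  have := runs_incr (zip2 (bit false :: l3) (bits w))
    (zip2 [::] (table_cells (table phi t.+4.+2))) t.+4.+2
    (written (family_word f3)) (written (query_word (o3 ++ [:: 2 ^ t.+4.+2]))).
  by rewrite e7 /state /f3 /f2 /f1 /f0 /o3 /o2 /o1 -!catA; exact.
rewrite /clause_cost e7.
move: (items_size (query_items _)) (items_size (family_items _)) slot_cost => c2 c1 sc.
set M := (t.+4.+3 + L).+1.
have MM : M <= M ^ 2 by rewrite -mulnn leq_pmulr.
have le2 x : x <= M -> sc * x ^ 2 <= sc * M ^ 2.
  by move=> xM; rewrite leq_mul2l leq_exp2r // xM orbT.
have le1 c x : x <= M -> c * x <= c * M ^ 2.
  by move=> xM; rewrite leq_mul2l (leq_trans xM MM) orbT.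
have a1 := le2 (t + L).+1; have a2 := le2 (t.+2 + L).+1.
have a3 := le2 (t.+4 + L).+1.
have a4 := le1 c1 t.+1.
have a5 := le1 c2 t.+4.+3.
have M1 : 1 <= M ^ 2 by rewrite expn_gt0.
have {}a1 := a1 ltac:(rewrite /M; lia); have {}a2 := a2 ltac:(rewrite /M; lia).
have {}a3 := a3 ltac:(rewrite /M; lia); have {}a4 := a4 ltac:(rewrite /M; lia).
have {}a5 := a5 ltac:(rewrite /M; lia).
have -> : (3 * sc + c1 + c2 + 5) * M ^ 2 =
    3 * (sc * M ^ 2) + c1 * M ^ 2 + c2 * M ^ 2 + 5 * M ^ 2.
  by move: (M ^ 2) => q; lia.
move: a1 a2 a3 a4 a5 M1; move: (M ^ 2) (c2 * M ^ 2) (c1 * M ^ 2) (sc * M ^ 2).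
move: (sc * _) (sc * _) (sc * _) (c1 * t.+1) (c2 * t.+4.+3).
by move=> *; lia.
Qed.

Definition clauses_prog : prog := While (on In (pred1 (bit true))) clause_prog.

Definition family_upto phi n := flatten [seq family_at phi t | t <- iota 0 n].
Definition query_upto phi n := flatten [seq query_at phi t | t <- iota 0 n].

Lemma runs_clauses L phi n l j f :
  is_3cnf phi ->
  (forall t l, literal_at phi t = Some l -> size (enc_lit l) <= L) ->
  j + n = size phi ->
  exists l',
    runs clauses_prog
      (state l (enc_cnf (drop j phi)) (7 * j) (table phi (7 * j))
        (f ++ family_upto phi (7 * j)) (query_upto phi (7 * j)))
      (state l' [:: false] (7 * size phi) (table phi (7 * size phi))
        (f ++ family_upto phi (7 * size phi)) (query_upto phi (7 * size phi)))
      (n * (clause_cost * (7 * size phi + L).+1 ^ 2).+1 + 1).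
Proof.
move=> h3 hL; elim: n l j => [|n IH] l j jn.
  rewrite addn0 in jn; rewrite -jn jn drop_size; exists l.
  by apply: runs_while0; rewrite /on /reads /= ?aread_zip2.
have jp : j < size phi by lia.
have sC : size (nth [::] phi j) <= 3 by apply: (allP h3); apply: mem_nth.
have [l1 h1] := @runs_clause L phi l (enc_cnf (drop j.+1 phi)) j
  (f ++ family_upto phi (7 * j)) (query_upto phi (7 * j)) sC hL.
have [|l2 h2] := IH l1 j.+1; first by lia.
exists l2.
have ef (A : Type) (g : nat -> seq A) :
    flatten [seq g t | t <- iota 0 (7 * j.+1)] =
    flatten [seq g t | t <- iota 0 (7 * j)] ++
    flatten [seq g t | t <- iota (7 * j) 7].
  by rewrite (_ : 7 * j.+1 = 7 * j + 7) ?iotaD ?map_cat ?flatten_cat //; lia.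
rewrite -catA -!ef in h1.
have -> : enc_cnf (drop j phi) = true :: enc_list enc_lit (nth [::] phi j) ++
    enc_cnf (drop j.+1 phi).
  by rewrite (drop_nth [::] jp) /enc_cnf enc_list_cons.
apply: runs_le (runs_whileS _ h1 h2).
  have : clause_cost * (7 * j.+1 + L).+1 ^ 2 <=
      clause_cost * (7 * size phi + L).+1 ^ 2.
    by rewrite leq_mul2l leq_exp2r //; apply/orP; right; lia.
  rewrite (mulSn n); move: (clause_cost * (7 * size phi + L).+1 ^ 2)
    (clause_cost * (7 * j.+1 + L).+1 ^ 2) (n * _) => x y z; lia.
by rewrite /on /reads /= ?aread_zip2.
Qed.

(** * Assembling the output word *)

Fixpoint prepend_prog (w : word) : prog :=
  if w is b :: w then
    Seq (prepend_prog w) (Seq (move Out GoLeft) (Put Out (Some (bit b)) Stay))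
  else skip.

Lemma runs_prepend w i t c f r :
  runs (prepend_prog w) (mk i t c f (zip2 [::] r))
    (mk i t c f (zip2 [::] (bits w ++ r))) (2 * size w + 1).
Proof.
elim: w => [|b w IH] /=; first exact: runs_skip.
refine (runs_le _ _); last first.
  apply: (runs_seq IH); apply: runs_put_seq.
  rewrite upd_mk awriteN [mk _ _ _ _ _ Out]/= amoveL0.
  have := runs_put Out (Some (bit b)) Stay
    (mk i t c f (zip2 [::] (None :: bits w ++ r))).
  by rewrite upd_mk awriteE; exact.
by rewrite /=; lia.
Qed.

Definition pour_prog : prog :=
  While (on Fam (predC1 None))
    (Seq (move Out GoLeft)
      (Seq (If (on Fam (pred1 (bit true))) (Put Out (Some (bit true)) Stay)
             (Put Out (Some (bit false)) Stay))
        (move Fam GoLeft))).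

Lemma runs_pour w z i t c r :
  runs pour_prog
    (mk i t c (amove GoLeft (zip2 (rev (bits w)) z)) (zip2 [::] r))
    (mk i t c (zip2 [::] (None :: bits w ++ z)) (zip2 [::] (bits w ++ r)))
    (5 * size w + 1).
Proof.
elim/last_ind: w z r => [|w b IH] z r.
  by rewrite amoveL0; apply: runs_while0; rewrite /on /reads /= ?aread_zip2.
have -> : rev (bits (rcons w b)) = bit b :: rev (bits w).
  by rewrite /bits /word_cells map_rcons rev_rcons.
have e (s : seq sym) : bits (rcons w b) ++ s = bits w ++ bit b :: s.
  by rewrite /bits /word_cells map_rcons cat_rcons.
rewrite !e amoveL; set s0 := mk _ _ _ _ _.
have h : runs (Seq (move Out GoLeft)
      (Seq (If (on Fam (pred1 (bit true))) (Put Out (Some (bit true)) Stay)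
             (Put Out (Some (bit false)) Stay))
        (move Fam GoLeft))) s0
    (mk i t c (amove GoLeft (zip2 (rev (bits w)) (bit b :: z)))
      (zip2 [::] (bit b :: r))) 4.
  rewrite /s0; apply: runs_put_seq; rewrite upd_mk awriteN [mk _ _ _ _ _ Out]/= amoveL0.
  apply: (@runs_seq _ _ _ _ _ 2 1).
    apply: (@runs_If_eq _ _ _ b); first by rewrite /on /reads /= ?aread_zip2; case: (b).
    rewrite (_ : (if b then _ else _) = Put Out (Some (bit b)) Stay); last by case: (b).
    exact: runs_put.
  rewrite upd_mk [mk _ _ _ _ _ Out]/= awriteE.
  have := runs_put Fam None GoLeft (mk i t c (zip2 (rev (bits w)) (bit b :: z))
    (zip2 [::] (bit b :: r))).
  by rewrite upd_mk.
apply: runs_le (runs_whileS _ h (IH _ _)); first by rewrite size_rcons; lia.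
by rewrite /s0 /on /reads /= ?aread_zip2.
Qed.

Definition prepend_tens_prog : prog :=
  While (on Cnt (pred1 bar)) (Seq (prepend_prog ten) (move Cnt GoLeft)).

Lemma runs_prepend_tens i t n z f r :
  runs prepend_tens_prog
    (mk i t (amove GoLeft (zip2 (marks n) z)) f (zip2 [::] r))
    (mk i t (zip2 [::] (None :: marks n ++ z)) f (zip2 [::] (bits (tens n) ++ r)))
    (7 * n + 1).
Proof.
elim: n z r => [|n IH] z r.
  by rewrite amoveL0; apply: runs_while0; rewrite /on /reads /= ?aread_zip2.
have em : marks n.+1 = bar :: marks n by [].
rewrite em cat_cons -marksS amoveL.
rewrite tensS bits_cat -catA.
have h := runs_prepend ten i t (zip2 (marks n) (bar :: z)) f r.
have h' := runs_put Cnt None GoLeft (mk i t (zip2 (marks n) (bar :: z)) f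
   (zip2 [::] (bits ten ++ r))).
rewrite upd_mk awriteN [mk _ _ _ _ _ Cnt]/= in h'.
apply: runs_le (runs_whileS _ (runs_seq h h') (IH _ _)); first by rewrite /=; lia.
by rewrite /on /reads /= ?aread_zip2.
Qed.

(** The output begins with the dimension and the family, which are complete only after the whole
    formula has been read. Therefore [Out] starts out as the query and the other parts are put in
    front of it from right to left. *)
Definition finish_prog : prog :=
  Seq (emitw Out (false :: enc_rat 0))
    (Seq (emitw Fam [:: false])
      (Seq (rewind Out (predC1 None))
        (Seq (move Fam GoLeft)
          (Seq pour_prog
            (Seq (prepend_prog [:: true; true; false])
              (Seq (move Cnt GoLeft) prepend_tens_prog)))))).

Definition output (T : nat) (f : seq (seq nat * rat)) (o : seq nat) : word :=
  enc_nat (2 ^ T) ++ (family_word f ++ [:: false]) ++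
  (query_word o ++ [:: false]) ++ enc_rat 0.

Definition finish_const : nat := 40 + 3 * size (enc_rat 0).

Lemma runs_finish l w T tb f o : exists2 s,
  runs finish_prog (state l w T tb f o) s
    (7 * T + 5 * size (family_word f) + 2 * size (query_word o) + finish_const) &
  s Out = zip2 [::] (bits (output T f o)).
Proof.
set i := zip2 l (bits w); set t := zip2 [::] (table_cells tb).
set F := family_word f ++ [:: false]; set O := query_word o ++ false :: enc_rat 0.
have h1 := @runs_emitw Out (query_word o) (false :: enc_rat 0) (state l w T tb f o) erefl.
rewrite upd_mk -/O in h1.
have h2 := @runs_emitw Fam (family_word f) [:: false]
  (mk i t (counter T) (written (family_word f)) (written O)) erefl.
rewrite upd_mk -/F in h2.
have h3 := @runs_rewind Out (predC1 None)
  (mk i t (counter T) (written F) (written O)) (rev (bits O)) [::] [::].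
rewrite cats0 all_rev all_bits_pred // in h3.
have {}h3 := h3 erefl erefl isT.
rewrite upd_mk revK cats0 size_rev size_map in h3.
have h4 := runs_put Fam None GoLeft (mk i t (counter T) (written F) (zip2 [::] (bits O))).
rewrite upd_mk awriteN [mk _ _ _ _ _ Fam]/= in h4.
have h5 := runs_pour F [::] i t (counter T) (bits O).
have h6 := runs_prepend [:: true; true; false] i t (counter T)
  (zip2 [::] (None :: bits F ++ [::])) (bits F ++ bits O).
have h7 := runs_put Cnt None GoLeft (mk i t (counter T)
  (zip2 [::] (None :: bits F ++ [::]))
  (zip2 [::] (bits [:: true; true; false] ++ bits F ++ bits O))).
rewrite upd_mk awriteN [mk _ _ _ _ _ Cnt]/= in h7.
have h8 := runs_prepend_tens i t T [::] (zip2 [::] (None :: bits F ++ [::]))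
  (bits [:: true; true; false] ++ bits F ++ bits O).
eexists.
  apply: runs_le (runs_seq h1 (runs_seq h2 (runs_seq h3 (runs_seq h4 (runs_seq h5
    (runs_seq h6 (runs_seq h7 h8))))))).
  by rewrite /O /F !size_cat /= /finish_const; lia.
have -> : bits (output T f o) =
    bits (tens T) ++ bits [:: true; true; false] ++ bits F ++ bits O.
  by rewrite /output enc_nat_exp /F /O -!bits_cat -!catA.
by [].
Qed.

Definition reduction_prog : prog :=
  Seq (emitw Fam (family_word [:: ([::], 1%R)])) (Seq clauses_prog finish_prog).

(** * Length bounds and the total running time *)

Lemma literal_at_Some phi t l : literal_at phi t = Some l ->
  exists2 C, C \in phi & l \in C.
Proof.
rewrite /literal_at; case: ifP => // _ h; exists (nth [::] phi (t %/ 7)).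
  apply: mem_nth; rewrite ltnNge; apply/negP => hs.
  by rewrite nth_default // onth0n in h.
rewrite -(@onth_nth _ l _ _ _ h); apply: mem_nth.
by rewrite -onthTE h.
Qed.

Lemma size_enc_list_mem (A : eqType) (e : A -> word) x s :
  x \in s -> size (e x) <= size (enc_list e s).
Proof.
elim: s => // y s IH; rewrite inE enc_list_cons size_cat /=.
by case/predU1P=> [->|/IH]; lia.
Qed.

Lemma size_literal_at phi t l :
  literal_at phi t = Some l -> size (enc_lit l) <= size (enc_cnf phi).
Proof.
case/literal_at_Some => C Cphi lC.
exact: leq_trans (size_enc_list_mem _ lC) (size_enc_list_mem _ Cphi).
Qed.

Lemma size_enc_list (A : Type) (e : A -> word) s :
  size s <= size (enc_list e s).
Proof. by elim: s => // x s IH; rewrite enc_list_cons size_cat /=; lia. Qed.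

Lemma mem_opposed tb l a :
  a \in opposed tb l -> exists2 l', (l', a) \in tb & l' = opposite l.
Proof.
case/mapP => -[l' a']; rewrite mem_filter /= => /andP[/eqP h1 h2] ->.
by exists l'.
Qed.

Lemma mem_table phi T l t :
  ((l, t) \in table phi T) = (t < T) && (literal_at phi t == Some l).
Proof.
rewrite /table mem_pmap; apply/mapP/andP => [[t']|[tT /eqP h]].
  rewrite mem_iota /= add0n => tT; case e: literal_at => [l'|] // [-> ->].
  by rewrite tT e.
by exists t; rewrite ?mem_iota ?add0n // h.
Qed.

Lemma mem_conflicts phi a t : a \in conflicts phi t ->
  a < t /\ exists l, literal_at phi t = Some l /\
                    literal_at phi a = Some (opposite l).
Proof.
rewrite /conflicts; case e: literal_at => [l|] // /mem_opposed[l' h el]; subst l'.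
move: h; rewrite mem_table => /andP[h1 /eqP h2]; split=> //.
by exists l.
Qed.

Lemma size_conflicts phi t : size (conflicts phi t) <= t.
Proof.
rewrite /conflicts; case: literal_at => // l; rewrite /opposed size_map size_filter.
exact: leq_trans (count_size _ _) (size_table _ _).
Qed.

Definition word_const : nat :=
  items_size (family_items clause_family) + conflict_cost + 30.

Lemma size_family_of t s : all (fun a => a < t) s ->
  size (family_word (family_of t s)) <= size s * (conflict_cost * t.+1).
Proof.
elim: s => // a s IH; rewrite [all _ _]/= => /andP[at_ /IH h].
have -> : family_of t (a :: s) = map (instance t a) conflict_family ++ family_of t s.
  by [].
rewrite family_word_cat size_cat mulSn; apply: leq_add => //.
rewrite -family_items_word //.
apply: leq_trans (size_items_word _ (ltnW at_)) _.
by rewrite leq_mul2r /conflict_cost leq_addr orbT.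
Qed.

(** There are at most [t] conflicts with earlier slots, and each contributes a bounded number of
    codes of length linear in [t]. *)
Lemma size_family_at phi t :
  size (family_word (family_at phi t)) <= word_const * t.+1 ^ 2.
Proof.
rewrite /family_at family_word_cat size_cat.
have h : size (family_word (family_of t (conflicts phi t))) <=
    t * (conflict_cost * t.+1).
  apply: leq_trans (size_family_of _) _.
    by apply/allP => a /mem_conflicts[].
  by rewrite leq_mul2r size_conflicts orbT.
have h' : size (family_word (if t %% 7 == 0 then map (instance t 0) clause_family
    else [::])) <= items_size (family_items clause_family) * t.+1.
  case: ifP => // _; rewrite -family_items_word //.
  exact: size_items_word.
apply: leq_trans (leq_add h' h) _; rewrite /word_const.
move: (items_size _) conflict_cost => x y; rewrite -mulnn; nia.
Qed.

Lemma size_query_word1 k : size (query_word [:: k]) = (size (enc_nat k)).+1.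
Proof. by rewrite /query_word [flatten _]cats0. Qed.

Lemma size_query_at phi t : size (query_word (query_at phi t)) <= 30 * t.+1 ^ 2.
Proof.
have h1 : size (query_word [:: 2 ^ t]) <= 30 * t.+1.
  by rewrite size_query_word1 enc_nat_exp size_cat size_tens /=; lia.
have h2 : size (query_word [seq 2 ^ a + 2 ^ t | a <- conflicts phi t]) <=
    t * (30 * t.+1).
  have h s : all (fun a => a < t) s ->
      size (query_word [seq 2 ^ a + 2 ^ t | a <- s]) <= size s * (30 * t.+1).
    elim: s => // a s IH; rewrite [all _ _]/= => /andP[at_ /IH hs].
    rewrite map_cons -[_ :: [seq _ | _ <- s]]cat1s query_word_cat size_cat.
    rewrite -[size (a :: s)]/(size s).+1 (mulSn (size s)).
    apply: leq_add; last exact: hs.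
    by rewrite size_query_word1 enc_nat_exp2 // !size_cat !size_tens /=; lia.
  apply: leq_trans (h _ _) _; first by apply/allP => a /mem_conflicts[].
  by rewrite leq_mul2r size_conflicts orbT.
rewrite /query_at -mulnn; case: ifP => _; first by nia.
case: ifP => _; first by case: literal_at => //; nia.
by nia.
Qed.

Lemma size_flatten_iota (A : Type) (g : nat -> seq A) c n :
  (forall t, size (g t) <= c * t.+1 ^ 2) ->
  size (flatten [seq g t | t <- iota 0 n]) <= n * (c * n.+1 ^ 2).
Proof.
move=> h.
have hs s : all (fun t => t < n) s ->
    size (flatten [seq g t | t <- s]) <= size s * (c * n.+1 ^ 2).
  elim: s => // t s IH; rewrite [all _ _]/= => /andP[tn /IH hs].
  rewrite map_cons flatten_cons size_cat -[size (t :: s)]/(size s).+1.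
  rewrite (mulSn (size s)); apply: leq_add => //.
  apply: leq_trans (h t) _; rewrite leq_mul2l leq_exp2r //.
  by apply/orP; right; rewrite ltnS ltnW.
by rewrite -{2}(size_iota 0 n) hs //; apply/allP => t; rewrite mem_iota.
Qed.

Lemma family_word_upto phi n :
  family_word (family_upto phi n) =
  flatten [seq family_word (family_at phi t) | t <- iota 0 n].
Proof.
rewrite /family_upto; elim: (iota 0 n) => // t s IH.
by rewrite !map_cons !flatten_cons family_word_cat IH.
Qed.

Lemma query_word_upto phi n :
  query_word (query_upto phi n) =
  flatten [seq query_word (query_at phi t) | t <- iota 0 n].
Proof.
rewrite /query_upto; elim: (iota 0 n) => // t s IH.
by rewrite !map_cons !flatten_cons query_word_cat IH.
Qed.

Lemma reduction_computes : exists c, forall phi, is_3cnf phi ->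
  computes_within (machine reduction_prog) (enc_cnf phi)
    (output (7 * size phi) (marginals phi) (queried phi))
    (c * (size (enc_cnf phi)).+1 ^ 3).
Proof.
(* Constants are introduced through existential statements so that they stay opaque to computation
   and to the arithmetic tactics. *)
have [K eK] : exists K, K = size (family_word [:: ([::], 1%R)]) by eexists.
have [A eA] : exists A, A = clause_cost * 64 by eexists.
have [g eg] : exists g : nat -> nat, forall x, g x = 7 * 64 * x by eexists.
exists (A + 6 * K + 60 + 5 * g word_const + 2 * g 30 + finish_const) => phi h3.
set N := size (enc_cnf phi); set J := size phi.
have JN : J <= N by apply: size_enc_list.
have [l h2] := runs_clauses [::] [:: ([::], 1%R)] h3 (@size_literal_at phi)
  (add0n (size phi)).
have [s h hs] := runs_finish l [:: false] (7 * J) (table phi (7 * J))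
  (marginals phi) (queried phi).
have h1 := @runs_emitw Fam [::] (family_word [:: ([::], 1%R)])
  (state [::] (enc_cnf phi) 0 [::] [::] [::]) erefl.
rewrite upd_mk muln0 drop0 cat0s in h1 h2.
apply: runs_computes hs.
refine (runs_le _ (runs_seq h1 (runs_seq h2 h))).
have sf : size (family_word (marginals phi)) <=
    K + 7 * J * (word_const * (7 * J).+1 ^ 2).
  rewrite -[marginals phi]/([:: _] ++ family_upto phi (7 * J)) family_word_cat size_cat.
  rewrite -eK leq_add2l family_word_upto; apply: size_flatten_iota => t.
  exact: size_family_at.
have sq : size (query_word (queried phi)) <= 7 * J * (30 * (7 * J).+1 ^ 2).
  rewrite -[queried phi]/(query_upto phi (7 * J)) query_word_upto.
  by apply: size_flatten_iota => t; exact: size_query_at.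
rewrite -eK -/J -/N; set n := N.+1.
(* Since [J <= N], the base is at most 8 * n; its square is the origin of the factor 64. *)
have b1 : (7 * J + N).+1 ^ 2 <= 64 * n ^ 2.
  by rewrite -[64]/(8 ^ 2) -expnMn leq_exp2r //; lia.
have b2 : (7 * J).+1 ^ 2 <= 64 * n ^ 2 by apply: leq_trans b1; rewrite leq_exp2r //; lia.
have b3 : J <= n by lia.
have b4 : n <= n ^ 3 by rewrite -{1}(expn1 n) leq_pexp2l.
have b5 : 1 <= n ^ 3 by rewrite expn_gt0.
have e3 : n * n ^ 2 = n ^ 3 by rewrite -expnS.
have c1 : J * (clause_cost * (7 * J + N).+1 ^ 2) <= A * n ^ 3.
  rewrite eA mulnCA -mulnA leq_mul2l; apply/orP; right.
  by rewrite -e3 mulnCA; apply: leq_mul.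
have c2 x : 7 * J * (x * (7 * J).+1 ^ 2) <= g x * n ^ 3.
  rewrite eg; have -> : 7 * 64 * x * n ^ 3 = 7 * n * (x * (64 * n ^ 2)).
    by rewrite -e3; move: (n ^ 2) => q; lia.
  by apply: leq_mul; rewrite ?leq_mul2l ?b2 ?orbT //; lia.
have {}sf := leq_trans sf (leq_add (leqnn K) (c2 _)).
have {}sq := leq_trans sq (c2 _).
have kk : K <= K * n ^ 3 by rewrite leq_pmulr // expn_gt0.
have kf : finish_const <= finish_const * n ^ 3 by rewrite leq_pmulr // expn_gt0.
rewrite mulnS -[finish_const]/(finish_const).
move: finish_const kk kf c1 sf sq b4 b5 b3 => D'.
have -> (a b c d m i : nat) : (a + 6 * b + 60 + 5 * c + 2 * d + m) * i =
  a * i + 6 * (b * i) + 60 * i + 5 * (c * i) + 2 * (d * i) + m * i by lia.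
move: (size (family_word _)) (size (query_word _)) => f q.
move: (J * (clause_cost * _)) (g word_const * n ^ 3) (A * n ^ 3) (K * n ^ 3) (g 30 * n ^ 3)
  (D' * n ^ 3) (n ^ 3).
by move=> *; lia.
Qed.

(** * The query computed by the program *)

Definition index_set (K : nat) (s : seq nat) : {set 'I_K} := [set i | val i \in s].

Definition reduction (phi : cnf) : entr_query :=
  let K := 2 ^ (7 * size phi) in
  @EntrQuery K [seq (index_set K c.1, c.2) | c <- marginals phi]
    (index_set K (queried phi)) 0%R.

(** The normal form in which [enc_set] lists a set: such a list is recovered from the set it
    denotes. *)
Definition increasing (K : nat) (s : seq nat) : bool :=
  sorted ltn s && all (fun k => k < K) s.

Lemma mem_index_set K s (i : 'I_K) : (i \in index_set K s) = (val i \in s).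
Proof. by rewrite inE. Qed.

Lemma enum_index_set K s : increasing K s ->
  [seq val i | i <- enum (index_set K s)] = s.
Proof.
case/andP=> ss sK; apply: (irr_sorted_eq ltn_trans ltnn) => //.
  apply: (subseq_sorted ltn_trans _ (iota_ltn_sorted 0 K)).
  rewrite -val_enum_ord; apply: map_subseq.
  by rewrite enumT unlock; apply: filter_subseq.
move=> k; apply/mapP/idP => [[i]|ks].
  by rewrite mem_enum mem_index_set => h ->.
have kK := allP sK _ ks.
by exists (Ordinal kK); rewrite // mem_enum mem_index_set.
Qed.

Lemma enc_index_set K s : increasing K s ->
  enc_set (index_set K s) = enc_list enc_nat s.
Proof. by move=> h; rewrite /enc_set enum_index_set. Qed.

Lemma index_set_inj K s s' : increasing K s -> increasing K s' ->
  index_set K s = index_set K s' -> s = s'.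
Proof. by move=> h h' e; rewrite -(enum_index_set h) e enum_index_set. Qed.

Lemma trunc_log_exp t : trunc_log 2 (2 ^ t) = t.
Proof. by apply: trunc_expnK. Qed.

Lemma lt_exp2 a b : a < b -> 2 ^ a < 2 ^ b.
Proof. by move=> ab; rewrite ltn_exp2l. Qed.

Lemma trunc_log_exp2 a t : a < t -> trunc_log 2 (2 ^ a + 2 ^ t) = t.
Proof.
move=> /lt_exp2 h; apply: trunc_log_eq => //.
by rewrite leq_addl /= expnS; lia.
Qed.

Definition is_slot (t : nat) : bool := t %% 7 \in [:: 0; 2; 4].

Lemma literal_at_slot phi t l : literal_at phi t = Some l -> is_slot t.
Proof. by rewrite /literal_at /is_slot; case: ifP. Qed.

Lemma literal_at_lt phi t l : literal_at phi t = Some l -> t < 7 * size phi.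
Proof.
rewrite /literal_at; case: ifP => // _ h.
suff : t %/ 7 < size phi by rewrite ltn_divLR // mulnC.
rewrite ltnNge; apply/negP => hs.
by rewrite nth_default // onth0n in h.
Qed.

Lemma conflicts_slot phi a t : a \in conflicts phi t ->
  [/\ a < t, is_slot a & is_slot t].
Proof.
case/mem_conflicts=> h [l [h1 h2]]; split=> //.
  exact: literal_at_slot h2.
exact: literal_at_slot h1.
Qed.

Lemma conflicts_lt phi a t : a \in conflicts phi t -> t < 7 * size phi.
Proof. by case/mem_conflicts=> _ [l [h _]]; apply: literal_at_lt h. Qed.

Lemma conflicts_sorted phi t : sorted ltn (conflicts phi t).
Proof.
rewrite /conflicts; case: literal_at => // l.
apply: (subseq_sorted ltn_trans _ (iota_ltn_sorted 0 t)).
rewrite /opposed; apply: (@subseq_trans _ [seq e.2 | e <- table phi t]).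
  by apply: map_subseq; apply: filter_subseq.
rewrite /table; elim: (iota 0 t) => // x s IH.
rewrite [pmap _ _]/=; case: literal_at => [l'|] /=; first by rewrite eqxx.
exact: subseq_trans IH (subseq_cons _ _).
Qed.

Lemma attr_eqP : Equality.axiom (fun x y : attr =>
  match x, y with
  | Here k, Here k' => k == k'
  | Old, Old | Both, Both => true
  | _, _ => false
  end).
Proof.
move=> [k||] [k'||]; try by constructor.
by apply: (iffP eqP) => [->|[->]].
Qed.

HB.instance Definition _ := hasDecEq.Build attr attr_eqP.

Definition clause_key (j : nat) (s : seq nat) : seq nat :=
  [seq 2 ^ (7 * j + k) | k <- s].

Definition conflict_key (t a : nat) (s : seq attr) : seq nat :=
  [seq attr_index t a x | x <- s].

Variant marginal_spec (phi : cnf) : seq nat * rat -> Prop :=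
  | MarginalEmpty : marginal_spec phi ([::], 1%R)
  | MarginalClause j s of j < size phi & s \in clause_sets :
      marginal_spec phi (clause_key j s, frequency 3 clause_bit s)
  | MarginalConflict t a s of a \in conflicts phi t & s \in conflict_sets :
      marginal_spec phi (conflict_key t a s, frequency 2 conflict_bit s).

Lemma instance_clause t s r :
  instance t 0 ([seq Here k | k <- s], r) = ([seq 2 ^ (t + k) | k <- s], r).
Proof. by rewrite /instance /= -map_comp. Qed.

Lemma marginalP phi c : c \in marginals phi <-> marginal_spec phi c.
Proof.
rewrite /marginals inE; split.
  case/predU1P=> [->|]; first by constructor.
  case/flattenP => _ /mapP[t ht ->]; rewrite mem_iota /= add0n in ht.
  rewrite /family_at mem_cat => /orP[|].
    case: eqP => // t7 /mapP[_ /mapP[s hs ->] ->]; rewrite instance_clause.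
    have et : t = 7 * (t %/ 7) by rewrite {1}(divn_eq t 7) t7 addn0 mulnC.
    rewrite et; constructor => //.
    by rewrite ltn_divLR // mulnC.
  case/flattenP => _ /mapP[a ha ->] /mapP[_ /mapP[s hs ->] ->].
  by constructor.
case=> [|j s jJ hs|t a s ha hs]; apply/predU1P; [by left|right|right].
  apply/flattenP; exists (family_at phi (7 * j)).
    by apply/mapP; exists (7 * j); rewrite // mem_iota /= add0n ltn_pmul2l.
  rewrite /family_at mem_cat modnMr eqxx; apply/orP; left.
  rewrite /clause_key -instance_clause; apply: map_f.
  by apply: (map_f (fun s => ([seq Here k | k <- s], frequency 3 clause_bit s))).
apply/flattenP; exists (family_at phi t).
  by apply/mapP; exists t; rewrite // mem_iota /= add0n (conflicts_lt ha).
rewrite /family_at mem_cat; apply/orP; right.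
apply/flattenP; exists (map (instance t a) conflict_family).
  exact: (map_f (fun a => map (instance t a) conflict_family)).
rewrite -[(conflict_key _ _ _, _)]/(instance t a (s, frequency 2 conflict_bit s)).
apply: map_f.
by apply: (map_f (fun s => (s, frequency 2 conflict_bit s))).
Qed.

Lemma clause_set_lt7 s k : s \in clause_sets -> k \in s -> k < 7.
Proof.
move=> hs; apply/allP: k; move: s hs; apply/allP; exact: isT.
Qed.

Lemma sorted_clause_set s : s \in clause_sets -> sorted ltn s.
Proof. by move: s; apply/allP. Qed.

Lemma sorted_map_mono (f : nat -> nat) s : {homo f : x y / x < y} ->
  sorted ltn s -> sorted ltn (map f s).
Proof. by move=> hf; rewrite sorted_map; apply: sub_sorted. Qed.

Lemma clause_index_lt n j k : j < n -> k < 7 -> 2 ^ (7 * j + k) < 2 ^ (7 * n).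
Proof. by move=> jn k7; apply: lt_exp2; lia. Qed.

Lemma conflict_set_attr s x :
  s \in conflict_sets -> x \in s -> x \in [:: Old; Here 0; Both].
Proof. by move=> hs; apply/allP: x; move: s hs; apply/allP. Qed.

Lemma conflict_index_lt n t a x : a < t -> t < n -> x \in [:: Old; Here 0; Both] ->
  attr_index t a x < 2 ^ n.
Proof.
move=> at_ tn; rewrite !inE => /or3P[] /eqP-> /=.
- by apply: lt_exp2; apply: ltn_trans tn.
- by rewrite addn0 lt_exp2.
have h1 := lt_exp2 at_; have h2 : 2 ^ t.+1 <= 2 ^ n by rewrite leq_exp2l.
by rewrite expnS in h2; lia.
Qed.

Lemma sorted_conflict_key t a s : a < t -> s \in conflict_sets ->
  sorted ltn (conflict_key t a s).
Proof.
move=> /lt_exp2 h; have h1 : 0 < 2 ^ a by rewrite expn_gt0.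
rewrite /conflict_sets !inE.
by case/or4P => [/eqP->|/eqP->|/eqP->|/orP[]/eqP->] /=; rewrite ?addn0; lia.
Qed.

Lemma marginals_increasing phi c :
  c \in marginals phi -> increasing (2 ^ (7 * size phi)) c.1.
Proof.
case/marginalP => [//|j s jJ hs|t a s ha hs]; apply/andP; split=> /=.
- apply: sorted_map_mono (sorted_clause_set hs) => x y xy.
  by rewrite lt_exp2 // ltn_add2l.
- by apply/allP => _ /mapP[k ks ->]; rewrite clause_index_lt // (clause_set_lt7 hs).
- by apply: sorted_conflict_key => //; have [] := mem_conflicts ha.
apply/allP => _ /mapP[x xs ->]; have [at_ _] := mem_conflicts ha.
by rewrite conflict_index_lt ?(conflicts_lt ha) // (conflict_set_attr hs).
Qed.

(** The blocks occupy successive dyadic intervals, so their concatenation remains increasing. *)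
Lemma query_at_bounds phi t k : k \in query_at phi t -> 2 ^ t <= k < 2 ^ t.+1.
Proof.
have h : 2 ^ t <= 2 ^ t < 2 ^ t.+1 by rewrite leqnn lt_exp2.
rewrite /query_at; case: ifP => _; first by rewrite inE => /eqP->.
case: ifP => _; first by case: literal_at => //; rewrite inE => /eqP->.
case/mapP => a /mem_conflicts[/lt_exp2 at_ _] ->; rewrite leq_addl expnS /=; lia.
Qed.

Lemma query_at_sorted phi t : sorted ltn (query_at phi t).
Proof.
rewrite /query_at; case: ifP => // _; case: ifP => _; first by case: literal_at.
apply: sorted_map_mono (conflicts_sorted _ _) => x y xy.
by rewrite ltn_add2r lt_exp2.
Qed.

Lemma queried_increasing phi : increasing (2 ^ (7 * size phi)) (queried phi).
Proof.
rewrite /queried; elim: (7 * size phi) => // n /andP[h1 h2].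
rewrite -[n.+1]addn1 iotaD map_cat flatten_cat /= add0n cats0; apply/andP; split.
  rewrite (sorted_pairwise ltn_trans) pairwise_cat.
  rewrite -!(sorted_pairwise ltn_trans) h1 query_at_sorted !andbT.
  apply/allrelP => x y /(allP h2) hx /query_at_bounds/andP[hy _].
  exact: leq_trans hx hy.
rewrite all_cat; apply/andP; split.
  by apply: sub_all h2 => x hx; rewrite addn1 (ltn_trans hx) // lt_exp2.
by apply/allP => x /query_at_bounds/andP[_]; rewrite addn1.
Qed.

(** The program writes lists of indices while the instance contains sets; the two codes agree
    because all these lists are increasing. *)
Lemma enc_reduction phi : enc_entr_query (reduction phi) =
  output (7 * size phi) (marginals phi) (queried phi).
Proof.
have e : enc_list (enc_pair (@enc_set _) enc_rat)
    (query_constraints (reduction phi)) = family_word (marginals phi) ++ [:: false].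
  rewrite /enc_list; congr (_ ++ _); rewrite -map_comp; congr flatten.
  apply/eq_in_map => c hc /=.
  by rewrite /enc_pair /= enc_index_set // marginals_increasing.
rewrite /enc_entr_query e /output [query_itemset _]/=.
by rewrite (enc_index_set (queried_increasing phi)).
Qed.

(** * Validity of the family: closure under subsets and distinctness *)

Lemma mem_bools (m : seq bool) : m \in bools (size m).
Proof.
elim: m => [|b m IH]; first by rewrite inE.
have inj c : injective (cons c : seq bool -> seq bool) by move=> x y [].
by rewrite /= mem_cat; case: b; rewrite (mem_map (inj _)) IH ?orbT.
Qed.

(** A finite check by evaluation, over all masks of all listed sets. *)
Lemma clause_sets_mask s m : s \in clause_sets -> size m = size s ->
  mask m s \in [::] :: clause_sets.
Proof.
move=> hs sm; have := mem_bools m; rewrite sm; move: m {sm}; apply/allP.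
move: s hs; apply/allP; exact: isT.
Qed.

Lemma conflict_sets_mask s m : s \in conflict_sets -> size m = size s ->
  mask m s \in [:: [::], [:: Old], [:: Here 0] & conflict_sets].
Proof.
move=> hs sm; have := mem_bools m; rewrite sm; move: m {sm}; apply/allP.
move: s hs; apply/allP; exact: isT.
Qed.

Lemma slot_set t : is_slot t -> [:: t %% 7] \in clause_sets.
Proof. by rewrite /is_slot; move: (t %% 7); apply/allP; exact: isT. Qed.

Lemma slot_div t : t = 7 * (t %/ 7) + t %% 7.
Proof. by rewrite {1}(divn_eq t 7) mulnC. Qed.

Lemma ltn_slot_div (phi : cnf) t : t < 7 * size phi -> t %/ 7 < size phi.
Proof. by move=> h; rewrite ltn_divLR // mulnC. Qed.

Lemma marginals_subseq phi c s : c \in marginals phi -> subseq s c.1 ->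
  s \in [seq c.1 | c <- marginals phi].
Proof.
have mem s' r : marginal_spec phi (s', r) -> s' \in [seq c.1 | c <- marginals phi].
  by move=> h; apply/mapP; exists (s', r) => //; apply/marginalP.
have clause j s' : j < size phi -> s' \in clause_sets ->
    clause_key j s' \in [seq c.1 | c <- marginals phi].
  by move=> jJ hs; apply: mem (MarginalClause jJ hs).
have empty : [::] \in [seq c.1 | c <- marginals phi] by apply: mem (MarginalEmpty _).
(* Singletons of slots are left out of [conflict_sets]; they are found in the family of the clause
   that owns the slot. *)
have single t : is_slot t -> t < 7 * size phi ->
    [:: 2 ^ t] \in [seq c.1 | c <- marginals phi].
  move=> ht tJ; have := clause _ _ (ltn_slot_div tJ) (slot_set ht).
  by rewrite /clause_key /= -slot_div.
case/marginalP => [|j s' jJ hs|t a s' ha hs] /subseqP[m sm ->].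
- by rewrite mask0.
- rewrite /clause_key -map_mask size_map in sm *.
  have := clause_sets_mask hs sm; rewrite inE => /predU1P[->//|].
  exact: clause.
rewrite /conflict_key -map_mask size_map in sm *.
have [at_ sa st] := conflicts_slot ha; have tJ := conflicts_lt ha.
have := conflict_sets_mask hs sm.
rewrite in_cons => /predU1P[->//|]; rewrite in_cons => /predU1P[->|].
  by rewrite /= single // (ltn_trans at_ tJ).
rewrite in_cons => /predU1P[->|hm]; first by rewrite /= addn0 single.
exact: mem (MarginalConflict ha hm).
Qed.

(** The decoder [d] recovers the block of an element, so distinct blocks are disjoint. *)
Lemma uniq_flatten_key (I J : eqType) (F : I -> seq J) (d : J -> I) r :
  uniq r -> (forall x, x \in r -> uniq (F x)) ->
  (forall x y, x \in r -> y \in F x -> d y = x) ->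
  uniq (flatten [seq F x | x <- r]).
Proof.
elim: r => // x r IH /= /andP[xr ur] uF dF.
rewrite cat_uniq uF ?mem_head //= IH //; last 2 first.
- by move=> y yr; apply: uF; rewrite inE yr orbT.
- by move=> y z yr; apply: dF; rewrite inE yr orbT.
rewrite andbT; apply/hasPn => z /flattenP[_ /mapP[y yr ->] zy].
apply: contra xr => zx; rewrite -(dF x z) ?mem_head // (dF y z) //.
by rewrite inE yr orbT.
Qed.

(* Recovers from a listed itemset the clause or the pair of slots it stems
   from; hence no itemset is listed twice. *)
Definition key_of (l : seq nat) : nat * option nat :=
  let x := last 0 l in let t := trunc_log 2 x in
  if x != 2 ^ t then (t, Some (trunc_log 2 (x - 2 ^ t)))
  else if (size l == 2) && is_slot t then (t, Some (trunc_log 2 (head 0 l)))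
  else (7 * (t %/ 7), None).

(** No two-element clause set ends in a slot, which distinguishes it from the pair of two
    conflicting slots. *)
Lemma key_clause j s : s \in clause_sets -> key_of (clause_key j s) = (7 * j, None).
Proof.
move=> hs; have : [&& s != [::], last 0 s < 7 &
    ~~ ((size s == 2) && (last 0 s \in [:: 0; 2; 4]))].
  by move: s hs; apply/allP; exact: isT.
case: s hs => // k s _ /and3P[_ h7 hn]; rewrite /key_of.
have -> : last 0 (clause_key j (k :: s)) = 2 ^ (7 * j + last 0 (k :: s)).
  exact: (last_map (fun k => 2 ^ (7 * j + k))).
rewrite trunc_log_exp eqxx /= /is_slot modn7 // size_map (negbTE hn).
by rewrite (mulnC 7 j) divnMDl // divn_small // addn0 mulnC.
Qed.

Lemma exp2_sum_neq a t : a < t -> 2 ^ a + 2 ^ t != 2 ^ t.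
Proof. by move=> _; rewrite -{2}[2 ^ t]add0n eqn_add2r -lt0n expn_gt0. Qed.

Lemma key_conflict t a s : a < t -> is_slot t -> s \in conflict_sets ->
  key_of (conflict_key t a s) = (t, Some a).
Proof.
move=> h st; rewrite /conflict_sets !inE.
have hb : key_of [:: 2 ^ a; 2 ^ t] = (t, Some a).
  by rewrite /key_of /= !trunc_log_exp eqxx st.
have hn l : last 0 l = 2 ^ a + 2 ^ t -> key_of l = (t, Some a).
  by rewrite /key_of => ->; rewrite trunc_log_exp2 // exp2_sum_neq // addnK trunc_log_exp.
by case/or4P => [/eqP->|/eqP->|/eqP->|/orP[]/eqP->] /=; rewrite /= ?addn0 ?hb // hn.
Qed.

(** The decoding is used at two levels: its first component separates the exponents [t], its second
    one the earlier slots [a] in conflict with the same [t]. *)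
Lemma uniq_marginals phi : uniq [seq c.1 | c <- marginals phi].
Proof.
pose F t := [seq c.1 | c <- family_at phi t].
have eF t : F t = (if t %% 7 == 0 then [seq clause_key (t %/ 7) s | s <- clause_sets]
      else [::]) ++
    flatten [seq [seq conflict_key t a s | s <- conflict_sets] | a <- conflicts phi t].
  rewrite /F /family_at map_cat; congr (_ ++ _).
    case: eqP => // t7; rewrite /clause_family -!map_comp; apply: eq_map => s /=.
    rewrite -map_comp; apply: eq_map => k /=.
    by rewrite {1}(slot_div t) t7 addn0.
  rewrite /family_of map_flatten -map_comp; congr flatten; exact: eq_map.
have keyF t y : y \in F t -> (key_of y).1 = t.
  rewrite eF mem_cat => /orP[|].
    case: eqP => // t7 /mapP[s hs ->]; rewrite key_clause //=.
    by rewrite [RHS]slot_div t7 addn0.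
  case/flattenP => _ /mapP[a ha ->] /mapP[s hs ->].
  by have [at_ _ st] := conflicts_slot ha; rewrite key_conflict.
have -> : [seq c.1 | c <- marginals phi] =
    [::] :: flatten [seq F t | t <- iota 0 (7 * size phi)].
  by rewrite /marginals /= map_flatten -map_comp.
rewrite /= -/F; apply/andP; split.
  apply/negP => /flattenP[_ /mapP[t _ ->]]; rewrite eF mem_cat => /orP[|].
    by case: eqP.
  by case/flattenP => _ /mapP[a ha ->].
apply: (@uniq_flatten_key _ _ F (fun y => (key_of y).1)); first exact: iota_uniq.
  move=> t _; rewrite eF cat_uniq; apply/and3P; split.
  - case: eqP => // _; rewrite map_inj_uniq //; apply: inj_map => x y.
    by move/eqP; rewrite eqn_exp2l // eqn_add2l => /eqP.
  - apply/hasPn => y /flattenP[_ /mapP[a ha ->] /mapP[s hs ->]].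
    have [at_ _ st] := conflicts_slot ha; apply/negP; case: eqP => // _.
    by case/mapP => s' hs' /(congr1 key_of); rewrite key_conflict // key_clause.
  apply: (@uniq_flatten_key _ _ _ (fun y => odflt 0 (key_of y).2)).
  - exact: sorted_uniq ltn_trans ltnn _ (conflicts_sorted _ _).
  - move=> a /conflicts_slot[/lt_exp2 at_ _ _].
    have a0 : 0 < 2 ^ a by rewrite expn_gt0.
    have e1 : (2 ^ a == 2 ^ t) = false by apply/eqP; lia.
    have e2 : (2 ^ a == 2 ^ a + 2 ^ t) = false by apply/eqP; lia.
    have e3 : (2 ^ t == 2 ^ a + 2 ^ t) = false by apply/eqP; lia.
    by rewrite /= addn0 !inE !eqseq_cons !(eq_sym _ (2 ^ a)) e1 e2 e3 ?andbF.
  move=> a y ha /mapP[s hs ->].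
  by have [at_ _ st] := conflicts_slot ha; rewrite key_conflict.
by move=> t y _; apply: keyF.
Qed.

Lemma constraint_sets phi :
  [seq c.1 | c <- query_constraints (reduction phi)] =
  [seq index_set (2 ^ (7 * size phi)) s | s <- [seq c.1 | c <- marginals phi]].
Proof.
have -> : query_constraints (reduction phi) =
  [seq (index_set (2 ^ (7 * size phi)) c.1, c.2) | c <- marginals phi] by [].
by rewrite -!map_comp.
Qed.

Lemma uniq_constraints phi :
  uniq [seq c.1 | c <- query_constraints (reduction phi)].
Proof.
rewrite constraint_sets.
rewrite map_inj_in_uniq ?uniq_marginals // => x y /mapP[c hc ->] /mapP[d hd ->].
by apply: index_set_inj; apply: marginals_increasing.
Qed.

Lemma antimonotonic_constraints phi :
  antimonotonic [seq c.1 | c <- query_constraints (reduction phi)].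
Proof.
set K := 2 ^ (7 * size phi).
rewrite constraint_sets => B C /mapP[_ /mapP[c hc ->] ->] CB.
(* A subset of a listed itemset is denoted by a subsequence of its list. *)
pose s := [seq k <- c.1 | k \in [seq val i | i <- enum C]].
have -> : C = index_set K s.
  apply/setP => i; rewrite mem_index_set mem_filter (mem_map val_inj) mem_enum.
  apply/idP/andP => [iC|[]//]; split=> //.
  by have := subsetP CB _ iC; rewrite mem_index_set.
apply: map_f; apply: marginals_subseq hc _; exact: filter_subseq.
Qed.

(** * The circuit of a formula *)

(** Attributes are addressed by plain numbers, with value false beyond the dimension, so gates can
    be evaluated without bound proofs. *)
Definition value_at (K : nat) (w : outcome K) (k : nat) : bool :=
  if insub k is Some i then w i else false.

Lemma value_at_val K (w : outcome K) (i : 'I_K) : value_at w i = w i.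
Proof. by rewrite /value_at valK. Qed.

Lemma value_at_out K (w : outcome K) k : K <= k -> value_at w k = false.
Proof. by move=> h; rewrite /value_at insubN // -leqNgt. Qed.

Lemma value_at_ffun K (h : 'I_K -> bool) (g : nat -> bool) k :
  (forall i : 'I_K, h i = g i) -> k < K ->
  value_at ([ffun i : 'I_K => h i] : outcome K) k = g k.
Proof. by move=> hg kK; rewrite -[k]/(val (Ordinal kK)) value_at_val ffunE hg. Qed.

Lemma forall_index_set K (w : outcome K) s : all (fun k => k < K) s ->
  [forall i in index_set K s, w i] = all (value_at w) s.
Proof.
move=> /allP sK; apply/forall_inP/allP => [h k ks|h i].
  have := h (Ordinal (sK k ks)); rewrite mem_index_set => /(_ ks).
  by rewrite -value_at_val.
by rewrite mem_index_set => /h; rewrite value_at_val.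
Qed.

Definition slot_value (K : nat) (w : outcome K) (t : nat) : bool :=
  value_at w (2 ^ t).

(** The index is decoded from its leading exponents; the equation [k == 2 ^ a + 2 ^ t] rejects
    numbers with more than two binary ones. Whatever is not a gate is a free attribute. *)
Definition is_gate (phi : cnf) (k : nat) : bool :=
  let t := trunc_log 2 k in
  if k == 2 ^ t then ~~ is_slot t
  else let a := trunc_log 2 (k - 2 ^ t) in
    (k == 2 ^ a + 2 ^ t) && (a \in conflicts phi t).

Definition gate_value (v : nat -> bool) (k : nat) : bool :=
  let t := trunc_log 2 k in
  if k == 2 ^ t then
    clause_bit [:: v (7 * (t %/ 7)); v (7 * (t %/ 7)).+2; v (7 * (t %/ 7)).+4]
      (t %% 7)
  else ~~ (v (trunc_log 2 (k - 2 ^ t)) && v t).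

Definition force (phi : cnf) (K : nat) (w : outcome K) : outcome K :=
  [ffun i : 'I_K => if is_gate phi i then gate_value (slot_value w) i else w i].

Definition circuit (phi : cnf) (K : nat) : {set outcome K} :=
  [set w | force phi w == w].

Lemma is_gate_exp phi t : is_gate phi (2 ^ t) = ~~ is_slot t.
Proof. by rewrite /is_gate trunc_log_exp eqxx. Qed.

Lemma is_gate_conflict phi a t : a \in conflicts phi t ->
  is_gate phi (2 ^ a + 2 ^ t).
Proof.
move=> h; have [at_ _ _] := conflicts_slot h.
rewrite /is_gate trunc_log_exp2 // (negbTE (exp2_sum_neq at_)) addnK.
by rewrite trunc_log_exp eqxx.
Qed.

Lemma gate_value_exp v j k : k < 7 ->
  gate_value v (2 ^ (7 * j + k)) =
  clause_bit [:: v (7 * j); v (7 * j).+2; v (7 * j).+4] k.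
Proof.
move=> k7; rewrite /gate_value trunc_log_exp eqxx modn7 //.
by rewrite (mulnC 7 j) divnMDl // (divn_small k7) addn0 mulnC.
Qed.

Lemma gate_value_conflict v a t : a < t ->
  gate_value v (2 ^ a + 2 ^ t) = ~~ (v a && v t).
Proof.
move=> at_; rewrite /gate_value trunc_log_exp2 // (negbTE (exp2_sum_neq at_)).
by rewrite addnK trunc_log_exp.
Qed.

Lemma is_slot_clause j k : k < 7 -> is_slot (7 * j + k) = (k \in [:: 0; 2; 4]).
Proof. by move=> k7; rewrite /is_slot modn7. Qed.

Lemma is_slot_offset j : [/\ is_slot (7 * j), is_slot (7 * j).+2 & is_slot (7 * j).+4].
Proof.
have h k := @is_slot_clause j k.
have := h 0 isT; have := h 2 isT; have := h 4 isT.
by rewrite !addnS addn0 => -> -> ->.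
Qed.

Lemma gate_value_ext phi v v' k : is_gate phi k ->
  (forall t, is_slot t -> v t = v' t) -> gate_value v k = gate_value v' k.
Proof.
rewrite /is_gate /gate_value => h e; case: ifP h => [_ _|_ /andP[_ /conflicts_slot[_ h1 h2]]].
  by have [h0 h2 h4] := is_slot_offset (trunc_log 2 k %/ 7); rewrite !e.
by rewrite !e.
Qed.

Lemma value_at_force phi K (w : outcome K) k : k < K ->
  value_at (force phi w) k =
  if is_gate phi k then gate_value (slot_value w) k else value_at w k.
Proof.
move=> kK; apply: (value_at_ffun (g := fun k => if is_gate phi k then
  gate_value (slot_value w) k else value_at w k)) => // i.
by rewrite value_at_val.
Qed.

Lemma slot_value_force phi K (w : outcome K) t : is_slot t ->
  slot_value (force phi w) t = slot_value w t.
Proof.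
move=> ht; rewrite /slot_value; case: (ltnP (2 ^ t) K) => hK; last by rewrite !value_at_out.
by rewrite value_at_force // is_gate_exp ht.
Qed.

Lemma force_ext phi K (w w' : outcome K) :
  (forall t, is_slot t -> slot_value w t = slot_value w' t) ->
  (forall k, ~~ is_gate phi k -> k < K -> value_at w k = value_at w' k) ->
  force phi w = force phi w'.
Proof.
move=> hs hk; apply/ffunP => i; rewrite !ffunE; case: ifPn => hi.
  exact: gate_value_ext hi hs.
by have := hk i hi (ltn_ord i); rewrite !value_at_val.
Qed.

(** Gates read slots only and no slot is a gate, so recomputing the gates a second time changes
    nothing. *)
Lemma force_circuit phi K (w : outcome K) : force phi w \in circuit phi K.
Proof.
rewrite inE; apply/eqP; apply: force_ext => [t|k hk kK].
  exact: slot_value_force.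
by rewrite value_at_force // (negbTE hk).
Qed.

Lemma circuit_force phi K (w : outcome K) : w \in circuit phi K -> force phi w = w.
Proof. by rewrite inE => /eqP. Qed.

Lemma circuit_gate phi K (w : outcome K) k : w \in circuit phi K -> k < K ->
  is_gate phi k -> value_at w k = gate_value (slot_value w) k.
Proof. by move=> /circuit_force hw kK hk; rewrite -{1}hw value_at_force // hk. Qed.

(** * Slots are independent fair bits on the circuit: counting by involutions *)

Definition flip (K e : nat) (w : outcome K) : outcome K :=
  [ffun i : 'I_K => w i (+) (val i == 2 ^ e)].

Lemma value_at_flip K e (w : outcome K) k : k < K ->
  value_at (flip e w) k = value_at w k (+) (k == 2 ^ e).
Proof.
apply: (value_at_ffun (g := fun k => value_at w k (+) (k == 2 ^ e))) => i.
by rewrite value_at_val.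
Qed.

Lemma slot_value_flip K e (w : outcome K) t : 2 ^ e < K ->
  slot_value (flip e w) t = slot_value w t (+) (t == e).
Proof.
move=> eK; rewrite /slot_value; case: (ltnP (2 ^ t) K) => hK.
  by rewrite value_at_flip // eqn_exp2l.
rewrite !value_at_out //; case: eqP => // te; move: hK; rewrite te leqNgt eK //.
Qed.

(** Negating a slot leaves the circuit, and recomputing the gates returns to it; the result is an
    involution of the circuit that changes a single slot. *)
Definition toggle (phi : cnf) (K e : nat) (w : outcome K) : outcome K :=
  force phi (flip e w).

Lemma slot_value_toggle phi K e (w : outcome K) t : 2 ^ e < K -> is_slot t ->
  slot_value (toggle phi e w) t = slot_value w t (+) (t == e).
Proof. by move=> eK ht; rewrite slot_value_force // slot_value_flip. Qed.

Lemma toggleK phi K e (w : outcome K) : 2 ^ e < K -> is_slot e ->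
  w \in circuit phi K -> toggle phi e (toggle phi e w) = w.
Proof.
move=> eK se hw; rewrite -{2}(circuit_force hw); apply: force_ext => [t ht|k hk kK].
  by rewrite slot_value_flip // slot_value_toggle // addbK.
by rewrite value_at_flip // value_at_force // (negbTE hk) value_at_flip // addbK.
Qed.

(** Toggling [e] exchanges the points with slot value true and those with slot value false, and
    preserves [Q]; so the two halves have equal size. *)
Lemma card_half phi K e (Q : pred (outcome K)) : 2 ^ e < K -> is_slot e ->
  (forall w, w \in circuit phi K -> Q (toggle phi e w) = Q w) ->
  forall b, 2 * #|[set w in circuit phi K | (slot_value w e == b) && Q w]| =
  #|[set w in circuit phi K | Q w]|.
Proof.
move=> eK se hQ; pose X b := [set w in circuit phi K | (slot_value w e == b) && Q w].
have sub b : #|X b| <= #|X (~~ b)|.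
  rewrite -(card_in_imset (f := toggle phi e) (D := X b)); last first.
    move=> w w' /setIdP[hw _] /setIdP[hw' _] h.
    by rewrite -(toggleK eK se hw) h toggleK.
  apply: subset_leq_card; apply/subsetP => _ /imsetP[w /setIdP[hw /andP[h q]] ->].
  rewrite inE force_circuit /= hQ // q slot_value_toggle // eqxx addbT.
  by rewrite (eqP h) eqxx.
have eqX b : #|X b| = #|X (~~ b)|.
  by apply/eqP; rewrite eqn_leq sub -{2}[b]negbK sub.
move=> b; rewrite -/(X b) mul2n -addnn {2}eqX -cardsUI.
have -> : X b :&: X (~~ b) = set0.
  by apply/setP => w; rewrite !inE; case: b; case: slot_value; rewrite ?andbF.
rewrite cards0 addn0; apply: eq_card => w; rewrite !inE.
by case: b; case: slot_value; rewrite /= ?andbF ?orbF.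
Qed.

(** Induction on the slots: the value of the first one is absorbed into [Q], which stays invariant
    under toggling the others because the slots are distinct. *)
Lemma card_pattern phi K (es : seq nat) (h : pred (seq bool)) (Q : pred (outcome K)) :
  uniq es -> all is_slot es -> all (fun e => 2 ^ e < K) es ->
  (forall e w, e \in es -> w \in circuit phi K -> Q (toggle phi e w) = Q w) ->
  2 ^ size es *
    #|[set w in circuit phi K | h (map (slot_value w) es) && Q w]| =
  #|[set w in circuit phi K | Q w]| * count h (bools (size es)).
Proof.
elim: es h Q => [|e es IH] h Q.
  rewrite /= mul1n addn0 => _ _ _ _; case: (h [::]); rewrite ?muln1 ?muln0 //.
  by apply: eq_card0 => w; rewrite !inE /= andbF.
rewrite [uniq _]/= [all is_slot _]/= [all (fun _ => _) _]/=.
move=> /andP[ne ue] /andP[se hs] /andP[eK hK] hQ.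
pose Qb b := [pred w : outcome K | (slot_value w e == b) && Q w].
have hQb b : #|[set w in circuit phi K | Qb b w]| * 2 = #|[set w in circuit phi K | Q w]|.
  by rewrite mulnC; apply: card_half => // w hw; rewrite hQ // mem_head.
have IHb b := IH (fun s => h (b :: s)) (Qb b) ue hs hK.
have {}IHb b : 2 ^ size es * #|[set w in circuit phi K |
      h (b :: map (slot_value w) es) && Qb b w]| =
    #|[set w in circuit phi K | Qb b w]| * count (fun s => h (b :: s)) (bools (size es)).
  apply: IHb => e' w he' hw; rewrite /Qb /= hQ // ?inE ?he' ?orbT //.
  rewrite slot_value_toggle ?(allP hK) // (_ : (e == e') = false) ?addbF //.
  by apply: contraNF ne => /eqP->.
have -> : #|[set w in circuit phi K | h (map (slot_value w) (e :: es)) && Q w]| =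
    #|[set w in circuit phi K | h (true :: map (slot_value w) es) && Qb true w]| +
    #|[set w in circuit phi K | h (false :: map (slot_value w) es) && Qb false w]|.
  rewrite -cardsUI (_ : _ :&: _ = set0) ?cards0 ?addn0; last first.
    by apply/setP => w; rewrite !inE /=; case: slot_value; rewrite ?andbF.
  apply: eq_card => w; rewrite !inE /=.
  by case: slot_value; rewrite ?andbF ?orbF.
rewrite /= expnS -mulnA mulnDr !IHb mulnDr count_cat !count_map mulnDr.
by rewrite -{1}(hQb true) -(hQb false); congr (_ + _); rewrite mulnC mulnAC.
Qed.

Lemma card_circuit_pattern phi K (es : seq nat) (h : pred (seq bool)) :
  uniq es -> all is_slot es -> all (fun e => 2 ^ e < K) es ->
  2 ^ size es * #|[set w in circuit phi K | h (map (slot_value w) es)]| =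
  #|circuit phi K| * count h (bools (size es)).
Proof.
move=> ue hs hK.
have := @card_pattern phi K es h predT ue hs hK (fun _ _ _ _ => erefl).
have e (P : pred (outcome K)) :
    #|[set w in circuit phi K | P w && predT w]| = #|[set w in circuit phi K | P w]|.
  by apply: eq_card => w; rewrite !inE andbT.
rewrite (e (fun w => h (map (slot_value w) es))) => ->; congr (_ * _).
by apply: eq_card => w; rewrite !inE andbT.
Qed.

Lemma frequency_circuit phi K (A : Type) (value : seq bool -> A -> bool) s es
    (P : pred (outcome K)) :
  uniq es -> all is_slot es -> all (fun e => 2 ^ e < K) es ->
  (forall w, w \in circuit phi K -> P w = all (value (map (slot_value w) es)) s) ->
  (#|[set w in circuit phi K | P w]|%:R =
   #|circuit phi K|%:R * frequency (size es) value s :> rat)%R.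
Proof.
move=> ue hs hK hP.
have -> : [set w in circuit phi K | P w] =
    [set w in circuit phi K | all (value (map (slot_value w) es)) s].
  apply/setP => w; apply/setIdP/setIdP => -[hw h]; split=> //.
    by rewrite -(hP _ hw).
  by rewrite (hP _ hw).
have := @card_circuit_pattern phi K es (fun b => all (value b) s) ue hs hK.
move/(congr1 (fun n => n%:R : rat)%R); rewrite !natrM => h.
have p0 : ((2 ^ size es)%:R != 0 :> rat)%R by rewrite pnatr_eq0 -lt0n expn_gt0.
apply: (mulfI p0); rewrite h /frequency mulrCA.
by rewrite [(_ * (_ / _))%R]mulrCA mulfV // mulr1.
Qed.

Lemma value_at_clause phi w j k : w \in circuit phi (2 ^ (7 * size phi)) ->
  j < size phi -> k < 7 ->
  value_at w (2 ^ (7 * j + k)) =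
  clause_bit [:: slot_value w (7 * j); slot_value w (7 * j).+2;
                 slot_value w (7 * j).+4] k.
Proof.
move=> hw jJ k7; case: (boolP (k \in [:: 0; 2; 4])) => hk; last first.
  rewrite (circuit_gate hw) ?clause_index_lt //; first exact: gate_value_exp.
  by rewrite is_gate_exp is_slot_clause.
by move: hk; rewrite !inE => /or3P[] /eqP->; rewrite ?addn0 ?addnS ?addn0.
Qed.

Lemma value_at_conflict phi w a t x : w \in circuit phi (2 ^ (7 * size phi)) ->
  a \in conflicts phi t -> x \in [:: Old; Here 0; Both] ->
  value_at w (attr_index t a x) = conflict_bit [:: slot_value w a; slot_value w t] x.
Proof.
move=> hw ha hx; have [at_ _ _] := conflicts_slot ha.
have hlt := conflict_index_lt at_ (conflicts_lt ha) hx.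
move: hx hlt; rewrite !inE => /or3P[] /eqP-> //= hlt; first by rewrite addn0.
by rewrite (circuit_gate hw) ?is_gate_conflict // gate_value_conflict.
Qed.

Lemma marginal_circuit phi c : c \in marginals phi ->
  (#|[set w in circuit phi (2 ^ (7 * size phi)) | all (value_at w) c.1]|%:R =
   #|circuit phi (2 ^ (7 * size phi))|%:R * c.2 :> rat)%R.
Proof.
case/marginalP => [|j s jJ hs|t a s ha hs].
- rewrite mulr1; congr (_%:R)%R; apply: eq_card => w.
  by rewrite inE /= andbT.
- have [h0 h2 h4] := is_slot_offset j.
  apply: (@frequency_circuit _ _ _ clause_bit s [:: 7 * j; (7 * j).+2; (7 * j).+4]).
  + by rewrite /= !inE; lia.
  + by rewrite /= h0 h2 h4.
  + by rewrite /= !lt_exp2 //; lia.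
  move=> w hw; rewrite /clause_key all_map; apply: eq_in_all => k ks /=.
  by rewrite (value_at_clause hw) // (clause_set_lt7 hs).
have [at_ sa st] := conflicts_slot ha; have tJ := conflicts_lt ha.
apply: (@frequency_circuit _ _ _ conflict_bit s [:: a; t]).
- by rewrite /= inE; lia.
- by rewrite /= sa st.
- by rewrite /= !lt_exp2 // (ltn_trans at_).
move=> w hw; rewrite /conflict_key all_map; apply: eq_in_all => x xs /=.
by rewrite (value_at_conflict hw ha) // (conflict_set_attr hs).
Qed.

(** * The frequencies confine the support to the circuit *)

Local Open Scope ring_scope.

Lemma complementary_support (R : realType) (K : nat) (p : outcome K -> R)
    (P Q : pred (outcome K)) : is_distr p ->
  \sum_(w | P w) p w + \sum_(w | Q w) p w = 1 ->
  \sum_(w | P w && Q w) p w = 0 ->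
  forall w, 0 < p w -> P w = ~~ Q w.
Proof.
case=> p0 p1 hPQ h0 w pw.
have zero (T : pred (outcome K)) : \sum_(w | T w) p w = 0 -> ~~ T w.
  move=> h; apply/negP => Tw.
  by have := psumr_eq0P (fun w _ => p0 w) h Tw => e; rewrite e ltxx in pw.
(* By inclusion-exclusion this mass is 1 - (p(P) + p(Q)) + p(P, Q). *)
have h1 : \sum_(w | ~~ P w && ~~ Q w) p w = 0.
  rewrite (bigID P) /= in p1; rewrite (bigID P) /= in hPQ.
  have e1 : \sum_(i | ~~ P i) p i =
      \sum_(i | ~~ P i && Q i) p i + \sum_(i | ~~ P i && ~~ Q i) p i.
    by rewrite (bigID Q).
  have e2 : \sum_(w | Q w) p w =
      \sum_(w | P w && Q w) p w + \sum_(w | ~~ P w && Q w) p w.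
    by rewrite (bigID P) /=; congr (_ + _); apply: eq_bigl => i; rewrite andbC.
  have e3 : \sum_(i | P i && P i) p i + \sum_(i | P i && ~~ P i) p i =
      \sum_(i | P i) p i.
    by rewrite -(bigID P).
  lra.
by have := zero _ h0; have := zero _ h1; case: (P w); case: (Q w).
Qed.

Section Support.
Variables (R : realType) (phi : cnf).
Let K := (2 ^ (7 * size phi))%N.
Variable p : outcome K -> R.
Hypothesis dp : is_distr p.
Hypothesis sp : satisfies p (query_constraints (reduction phi)).

Lemma sum_marginal c : c \in marginals phi ->
  \sum_(w | all (value_at w) c.1) p w = ratr c.2.
Proof.
move=> hc; have h := sp (map_f (fun c => (index_set K c.1, c.2)) hc).
rewrite -h; apply: eq_bigl => w; rewrite forall_index_set //.
by have /andP[] := marginals_increasing hc.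
Qed.

Lemma complementary_marginals w s1 s2 s3 r1 r2 r3 : 0 < p w ->
  (s1, r1) \in marginals phi -> (s2, r2) \in marginals phi ->
  (s3, r3) \in marginals phi ->
  perm_eq s3 (s1 ++ s2) -> r1 + r2 = 1 -> r3 = 0 ->
  all (value_at w) s1 = ~~ all (value_at w) s2.
Proof.
move=> pw h1 h2 h3 h12 r12 r30.
apply: (complementary_support (P := fun w => all (value_at w) s1)
  (Q := fun w => all (value_at w) s2) dp) pw.
  by rewrite (sum_marginal h1) (sum_marginal h2) -rmorphD r12 rmorph1.
have h : \sum_(v | all (value_at v) s3) p v = ratr r3 := sum_marginal h3.
rewrite r30 rmorph0 in h; rewrite -[RHS]h.
by apply: eq_bigl => v; rewrite (perm_all _ h12) all_cat.
Qed.

(** The frequencies are 1/2 and 1/2, with joint frequency 0. *)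
Lemma support_negation w j k : 0 < p w -> (j < size phi)%N -> k \in [:: 0; 2; 4]%N ->
  value_at w (2 ^ (7 * j + k).+1) = ~~ value_at w (2 ^ (7 * j + k)).
Proof.
move=> pw jJ hk.
have m s : s \in clause_sets ->
    (clause_key j s, frequency 3 clause_bit s) \in marginals phi.
  by move=> hs; apply/marginalP; constructor.
have hs : all (fun k => [&& [:: k.+1] \in clause_sets, [:: k] \in clause_sets &
    [:: k; k.+1] \in clause_sets]) [:: 0; 2; 4]%N by [].
have /and3P[s1 s2 s3] := allP hs k hk.
have := complementary_marginals pw (m _ s1) (m _ s2) (m _ s3); rewrite /clause_key /= !andbT addnS.
apply => //.
- by rewrite perm_sym (perm_catC [:: _] [:: _]).
- by move: hk; rewrite !inE => /or3P[] /eqP->; rewrite /frequency /=; lra.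
by move: hk; rewrite !inE => /or3P[] /eqP->; rewrite /frequency /=; lra.
Qed.

(** Attribute 6 has frequency 7/8, the conjunction of the three negations has 1/8, and together they
    have 0. The negations are then replaced by the slots through De Morgan. *)
Lemma support_clause w j : 0 < p w -> (j < size phi)%N ->
  value_at w (2 ^ (7 * j + 6)) =
  [|| value_at w (2 ^ (7 * j)), value_at w (2 ^ (7 * j).+2) |
      value_at w (2 ^ (7 * j).+4)].
Proof.
move=> pw jJ.
have m s : s \in clause_sets ->
    (clause_key j s, frequency 3 clause_bit s) \in marginals phi.
  by move=> hs; apply/marginalP; constructor.
have := complementary_marginals pw (m [:: 6] isT) (m [:: 1; 3; 5] isT)
  (m [:: 1; 3; 5; 6] isT).
have n0 := support_negation pw jJ (isT : 0 \in [:: 0; 2; 4])%N.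
have n2 := support_negation pw jJ (isT : 2 \in [:: 0; 2; 4])%N.
have n4 := support_negation pw jJ (isT : 4 \in [:: 0; 2; 4])%N.
rewrite !addnS addn0 in n0 n2 n4.
rewrite /clause_key /= !andbT !addnS addn0 n0 n2 n4 => -> //.
  by rewrite !negb_and !negbK.
by rewrite perm_sym (perm_catC [:: _] [:: _; _; _]).
Qed.

(** The frequencies are 3/4 and 1/4, with joint frequency 0. *)
Lemma support_conflict w a t : 0 < p w -> a \in conflicts phi t ->
  value_at w (2 ^ a + 2 ^ t) = ~~ (value_at w (2 ^ a) && value_at w (2 ^ t)).
Proof.
move=> pw ha.
have m s : s \in conflict_sets ->
    (conflict_key t a s, frequency 2 conflict_bit s) \in marginals phi.
  by move=> hs; apply/marginalP; constructor.
have := complementary_marginals pw (m [:: Both] isT) (m [:: Old; Here 0] isT)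
  (m [:: Old; Here 0; Both] isT).
rewrite /conflict_key /= !andbT addn0; apply=> //.
by rewrite perm_sym (perm_catC [:: _] [:: _; _]).
Qed.

Lemma support_circuit w : 0 < p w -> w \in circuit phi K.
Proof.
move=> pw; rewrite inE; apply/eqP/ffunP => i; rewrite ffunE.
case: ifPn => // hi; rewrite -value_at_val.
move: hi (ltn_ord i); rewrite /is_gate; move: (trunc_log 2 i) => t.
case: eqP => [->|_] hi iK; last first.
  move: hi; move: (trunc_log 2 (i - 2 ^ t)) => a /andP[/eqP-> ha].
  have [at_ _ _] := conflicts_slot ha.
  by rewrite support_conflict // gate_value_conflict.
have tJ : (t < 7 * size phi)%N by rewrite -(ltn_exp2l _ _ (isT : 1 < 2)%N).
have jJ := ltn_slot_div tJ; rewrite (slot_div t).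
have k7 : (t %% 7 < 7)%N by rewrite ltn_mod.
rewrite gate_value_exp //; move: hi; rewrite /is_slot; clear iK.
move: (t %/ 7)%N (t %% 7)%N jJ k7 => j [|[|[|[|[|[|[|]]]]]]] // jJ _ _.
- have := support_negation pw jJ (isT : 0 \in [:: 0; 2; 4])%N.
  by rewrite !addnS !addn0.
- have := support_negation pw jJ (isT : 2 \in [:: 0; 2; 4])%N.
  by rewrite !addnS !addn0.
- have := support_negation pw jJ (isT : 4 \in [:: 0; 2; 4])%N.
  by rewrite !addnS !addn0.
by rewrite support_clause.
Qed.

End Support.

(** * The maximum entropy distribution *)

Definition uniform (R : realType) (K : nat) (S : {set outcome K}) (w : outcome K) : R :=
  if w \in S then #|S|%:R^-1 else 0.

Lemma sum_uniform (R : realType) (K : nat) (S : {set outcome K}) (P : pred (outcome K)) :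
  \sum_(w | P w) uniform R S w = #|[set w in S | P w]|%:R / #|S|%:R.
Proof.
rewrite /uniform -big_mkcondr /= sumr_const mulr_natl; congr (_ *+ _).
by apply: eq_card => w; rewrite !inE andbC.
Qed.

Lemma uniform_distr (R : realType) (K : nat) (S : {set outcome K}) :
  (0 < #|S|)%N -> is_distr (@uniform R K S).
Proof.
move=> S0; split=> [w|].
  by rewrite /uniform; case: ifP => // _; rewrite invr_ge0 ler0n.
rewrite sum_uniform (_ : [set w in S | true] = S); last first.
  by apply/setP => w; rewrite inE andbT.
by rewrite divff // pnatr_eq0 -lt0n.
Qed.

Lemma entropy_uniform (R : realType) (K : nat) (S : {set outcome K}) :
  (0 < #|S|)%N -> entropy (@uniform R K S) = ln #|S|%:R.
Proof.
move=> S0; rewrite /entropy (bigID (mem S)) /= [X in _ + X]big1 ?addr0; last first.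
  by move=> w wS; rewrite /uniform (negbTE wS) mul0r.
rewrite (eq_bigr (fun=> #|S|%:R^-1 * ln #|S|%:R^-1)); last first.
  by move=> w wS; rewrite /uniform wS.
have S0' : (0 < #|S|%:R :> R) by rewrite ltr0n.
rewrite sumr_const -[_ * _ *+ _]mulr_natl mulrA divff ?mul1r ?lnV ?opprK //.
by rewrite gt_eqF.
Qed.

(** Gibbs' inequality against the uniform distribution on [S]: in the sum over [S] of the pointwise
    bounds [term], the corrections 1/N - p(w) cancel. *)
Lemma entropy_le (R : realType) (K : nat) (S : {set outcome K}) (p : outcome K -> R) :
  (0 < #|S|)%N -> is_distr p -> (forall w, 0 < p w -> w \in S) ->
  entropy p <= ln #|S|%:R.
Proof.
move=> S0 [p0 p1] pS; set N : R := #|S|%:R.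
have N0 : 0 < N by rewrite ltr0n.
have out w : w \notin S -> p w = 0.
  move=> wS; apply/eqP; rewrite eq_le p0 andbT leNgt.
  by apply: contra wS => /pS.
have term x : 0 <= x -> - (x * ln x) <= x * ln N + (N^-1 - x).
  rewrite le_eqVlt => /predU1P[<-|x0]; first by rewrite !(mul0r, oppr0, add0r, addr0) invr_ge0 ltW.
  have Nx0 : 0 < N * x by rewrite mulr_gt0.
  (* This is ln y <= y - 1 at y = 1/(N x); multiplied by [x] it becomes the claim. *)
  have h := expR_ge1Dx (ln (N * x)^-1).
  rewrite lnK ?posrE ?invr_gt0 // lnV ?posrE // lnM ?posrE // in h.
  have := ler_wpM2l (ltW x0) h; rewrite invfM mulrCA divff ?gt_eqF // mulr1.
  by lra.
have sumS (f : outcome K -> R) : (forall w, w \notin S -> f w = 0) ->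
    \sum_w f w = \sum_(w in S) f w.
  by move=> hf; rewrite (bigID (mem S)) /= [X in _ + X]big1 ?addr0.
rewrite /entropy -sumrN sumS; last by move=> w /out->; rewrite mul0r oppr0.
apply: le_trans (ler_sum _ (fun w _ => term _ (p0 w))) _.
rewrite big_split /= -mulr_suml sumrB sumr_const -sumS // p1 mul1r.
by rewrite -[N^-1 *+ _]mulr_natl divff ?gt_eqF // subrr addr0.
Qed.

Section Correctness.
Variables (R : realType) (phi : cnf).
Let K := (2 ^ (7 * size phi))%N.
Let S := circuit phi K.
Let F := query_constraints (reduction phi).

Lemma circuit_gt0 : (0 < #|S|)%N.
Proof. by apply/card_gt0P; exists (force phi [ffun=> false]); apply: force_circuit. Qed.

Lemma uniform_satisfies : satisfies (@uniform R K S) F.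
Proof.
move=> _ /mapP[c hc ->] /=; rewrite /prob_all1 sum_uniform.
have /andP[_ cK] := marginals_increasing hc.
have -> : [set w in S | [forall i in index_set K c.1, w i]] =
    [set w in S | all (value_at w) c.1].
  by apply/setP => w; rewrite !in_set forall_index_set.
have := congr1 (@ratr R) (marginal_circuit hc).
rewrite rmorphM /= !ratr_nat => ->.
by rewrite [X in X / _]mulrC mulfK // pnatr_eq0 -lt0n circuit_gt0.
Qed.

Lemma uniform_maxent : is_maxent F (@uniform R K S).
Proof.
split; [exact: uniform_distr circuit_gt0|exact: uniform_satisfies|].
move=> p dp sp; rewrite entropy_uniform ?circuit_gt0 //.
by apply: (entropy_le circuit_gt0 dp) => w; apply: support_circuit dp sp _.
Qed.

Lemma reduction_valid : entr_query_valid R (reduction phi).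
Proof.
split; first by rewrite expn_gt0.
- exact: uniq_constraints.
- exact: antimonotonic_constraints.
exists (@uniform R K S); split; [exact: uniform_distr circuit_gt0|].
exact: uniform_satisfies.
Qed.

(** A maximiser satisfies the frequencies, so positive mass on the query lies at a point of [S];
    conversely the uniform maximiser charges every point of [S]. *)
Lemma reduction_yes_iff :
  entr_query_yes R (reduction phi) <->
  exists2 w, w \in S & all (value_at w) (queried phi).
Proof.
have /andP[_ qK] := queried_increasing phi.
split=> [[q [dq sq _]]|[w wS hw]].
  rewrite /= rmorph0 => h; have [q0 _] := dq.
  have [w /andP[hw qw]] : exists w : outcome K,
      [forall i in index_set K (queried phi), w i] && (0 < q w).
    apply: contrapT => hn; move: h; rewrite /prob_all1 big1 ?ltxx // => w hw.
    apply/eqP; rewrite eq_le q0 andbT leNgt; apply/negP => qw.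
    by apply: hn; exists w; rewrite hw qw.
  exists w; first exact: (support_circuit dq sq qw).
  by rewrite -forall_index_set.
exists (@uniform R K S); first exact: uniform_maxent.
rewrite /= rmorph0 /prob_all1 sum_uniform divr_gt0 ?ltr0n ?circuit_gt0 //.
apply/card_gt0P; exists w; rewrite inE wS /= forall_index_set //.
Qed.

End Correctness.

Local Close Scope ring_scope.

(** * Queried points of the circuit correspond to satisfying assignments *)

Lemma mem_queried phi k :
  (k \in queried phi) = has (fun t => k \in query_at phi t) (iota 0 (7 * size phi)).
Proof.
apply/flattenP/hasP => [[_ /mapP[t ht ->] kt]|[t ht kt]]; first by exists t.
by exists (query_at phi t) => //; apply: map_f.
Qed.

Lemma queried_exp phi t : t < 7 * size phi -> t %% 7 = 6 -> 2 ^ t \in queried phi.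
Proof.
move=> tJ t6; rewrite mem_queried; apply/hasP; exists t.
  by rewrite mem_iota /= add0n.
by rewrite /query_at t6 mem_head.
Qed.

Lemma queried_missing phi t : t < 7 * size phi -> is_slot t ->
  literal_at phi t = None -> 2 ^ t.+1 \in queried phi.
Proof.
move=> tJ st lt; rewrite mem_queried; apply/hasP; exists t.+1.
  have t4 : t %% 7 <= 4 by move: st; rewrite /is_slot !inE => /or3P[] /eqP->.
  by rewrite mem_iota /= add0n; lia.
rewrite /query_at /= lt.
suff /andP[/negbTE-> ->] : (t.+1 %% 7 != 6) && odd (t.+1 %% 7) by rewrite mem_head.
move: st; rewrite -addn1 -modnDml /is_slot !inE.
by case/or3P => /eqP->.
Qed.

Lemma queried_conflict phi a t : a \in conflicts phi t ->
  2 ^ a + 2 ^ t \in queried phi.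
Proof.
move=> ha; have [_ _ st] := conflicts_slot ha.
rewrite mem_queried; apply/hasP; exists t.
  by rewrite mem_iota /= add0n (conflicts_lt ha).
have /andP[h6 ho] : (t %% 7 != 6) && ~~ odd (t %% 7).
  by move: st; rewrite /is_slot !inE => /or3P[] /eqP->.
rewrite /query_at (negbTE h6) (negbTE ho).
exact: (map_f (fun a => 2 ^ a + 2 ^ t)).
Qed.

Lemma literal_atE phi j i : i < 3 ->
  literal_at phi (7 * j + 2 * i) = onth (nth [::] phi j) i.
Proof.
move=> i3; rewrite literal_at_clause; last by lia.
by case: i i3 => [|[|[|]]].
Qed.

Lemma satisfiable_circuit phi : is_3cnf phi -> satisfiable phi ->
  exists2 w, w \in circuit phi (2 ^ (7 * size phi)) & all (value_at w) (queried phi).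
Proof.
move=> h3 [v hv]; set K := 2 ^ _.
(* Select exactly the literals true under [v], and no missing one. Only the slots of [u] matter, as
   every queried attribute is a gate. *)
pose s t := if literal_at phi t is Some l then eval_literal v l else false.
pose u : outcome K := [ffun i : 'I_K => s (trunc_log 2 i)].
have su t : t < 7 * size phi -> slot_value u t = s t.
  move=> tJ; rewrite /slot_value (@value_at_ffun _ _ (fun k => s (trunc_log 2 k))) //.
    by rewrite trunc_log_exp.
  exact: lt_exp2.
have wS := force_circuit phi u; set w := force phi u in wS.
have sw t : is_slot t -> t < 7 * size phi -> slot_value w t = s t.
  by move=> ht tJ; rewrite slot_value_force // su.
exists w => //; apply/allP => k; rewrite mem_queried => /hasP[t].
rewrite mem_iota /= add0n => tJ; rewrite /query_at.
have jJ := ltn_slot_div tJ; have [s0 s2 s4] := is_slot_offset (t %/ 7).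
case: eqP => [t6|t6].
  rewrite inE => /eqP->; rewrite (slot_div t) t6 (value_at_clause wS) //=.
  rewrite !sw //; try lia.
  have Cphi : nth [::] phi (t %/ 7) \in phi by apply: mem_nth.
  have /hasP[l lC vl] := allP hv _ Cphi.
  have sC : size (nth [::] phi (t %/ 7)) <= 3 := allP h3 _ Cphi.
  have iC := lC; rewrite -index_mem in iC.
  have lt : literal_at phi (7 * (t %/ 7) + 2 * index l (nth [::] phi (t %/ 7))) = Some l.
    rewrite literal_atE; last exact: leq_trans iC sC.
    by rewrite onthE (nth_map l) // nth_index.
  have st : s (7 * (t %/ 7) + 2 * index l (nth [::] phi (t %/ 7))) by rewrite /s lt.
  move: st (leq_trans iC sC); case: (index l _) => [|[|[|]]] //.
  - by rewrite addn0 => ->.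
  - by rewrite !addnS addn0 => ->; rewrite orbT.
  by rewrite !addnS addn0 => ->; rewrite !orbT.
case: ifP => [todd|teven].
  case lt: literal_at => [l|] //; rewrite inE => /eqP->.
  have k7 : t %% 7 < 7 by rewrite ltn_mod.
  rewrite {1}(slot_div t) (value_at_clause wS) // !sw //; try lia.
  move: lt; rewrite {1}(slot_div t); move: todd t6 k7.
  case: (t %% 7) => [|[|[|[|[|[|[|]]]]]]] //= _ _ _.
  - by rewrite addn1 /= /s => ->.
  - by rewrite !addnS addn0 /= /s => ->.
  by rewrite !addnS addn0 /= /s => ->.
(* Opposite literals are not both true under [v], so they are not both selected. *)
case/mapP => a ha ->; have [at_ sa st] := conflicts_slot ha.
have := value_at_conflict wS ha (isT : Both \in [:: Old; Here 0; Both]).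
rewrite /= => ->; rewrite !sw ?(ltn_trans at_ tJ) //.
have [_ [l [h1 h2]]] := mem_conflicts ha.
by rewrite /s h1 h2 /eval_literal /=; case: (v l.2); case: l.1.
Qed.

Lemma circuit_satisfiable phi w : is_3cnf phi ->
  w \in circuit phi (2 ^ (7 * size phi)) -> all (value_at w) (queried phi) ->
  satisfiable phi.
Proof.
move=> h3 wS /allP hq.
pose chosen l t := (literal_at phi t == Some l) && slot_value w t.
(* A variable is true iff one of its positive occurrences is selected. A selected negative literal
   is then satisfied, since a selected positive one would be in conflict with it. *)
pose v x := has (chosen (true, x)) (iota 0 (7 * size phi)).
exists v; apply/allP => C Cphi; set j := index C phi.
have jJ : j < size phi by rewrite index_mem.
have eC : nth [::] phi j = C by rewrite nth_index.
have sC : size C <= 3 := allP h3 _ Cphi.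
have [s0 s2 s4] := is_slot_offset j.
have hc := hq _ (@queried_exp phi (7 * j + 6) _ (@modn7 j 6 isT)).
have {hc} : value_at w (2 ^ (7 * j + 6)) by apply: hc; lia.
rewrite (value_at_clause wS) //= => hsel.
have {hsel}[i i3 hi] : exists2 i, i < 3 & slot_value w (7 * j + 2 * i).
  case/or3P: hsel => h; [exists 0|exists 1|exists 2] => //.
  - by rewrite addn0.
  - by rewrite !addnS addn0.
  by rewrite !addnS addn0.
have st : is_slot (7 * j + 2 * i).
  by rewrite is_slot_clause; [case: i i3 {hi} => [|[|[|]]]|lia].
have tJ : 7 * j + 2 * i < 7 * size phi by lia.
(* If the selected slot were empty, its queried negation would contradict the selection. *)
case lt: (literal_at phi (7 * j + 2 * i)) => [l|]; last first.
  have := hq _ (queried_missing tJ st lt).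
  rewrite -addnS (value_at_clause wS) //; last by lia.
  move: hi; case: i i3 {st tJ lt} => [|[|[|]]] //= _; rewrite ?addn0 ?addnS ?addn0 /= => ->; by [].
have lC : l \in C.
  move: lt; rewrite literal_atE // eC => hl.
  by rewrite -(@onth_nth _ l _ _ _ hl) mem_nth // -onthTE hl.
apply/hasP; exists l => //; rewrite /eval_literal /v.
case: l lt {lC} => -[] x lt /=.
  apply/eqP/hasP; exists (7 * j + 2 * i); first by rewrite mem_iota.
  by rewrite /chosen lt eqxx.
rewrite eqbF_neg; apply/hasP => -[t]; rewrite mem_iota /= add0n => tJ'.
rewrite /chosen => /andP[/eqP lt' ht].
have conf a b l' : a < b -> literal_at phi b = Some l' ->
    literal_at phi a = Some (opposite l') -> slot_value w a -> slot_value w b -> False.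
  move=> ab hb ha wa wb.
  have hab : a \in conflicts phi b.
    rewrite /conflicts hb /opposed; apply/mapP; exists (opposite l', a) => //.
    by rewrite mem_filter eqxx mem_table ab ha eqxx.
  have := hq _ (queried_conflict hab).
  have := value_at_conflict wS hab (isT : Both \in [:: Old; Here 0; Both]).
  by rewrite /= => ->; rewrite wa wb.
(* A conflict is recorded at the later of its two slots, so both orders occur; equality would put
   opposite literals into one slot. *)
case: (ltngtP t (7 * j + 2 * i)) => htt.
- exact: (conf _ _ _ htt lt lt' ht hi).
- exact: (conf _ _ _ htt lt' lt hi ht).
by move: lt'; rewrite htt lt.
Qed.

Theorem theorem4 (R : realType) :
  poly_time_reducible three_sat (entr_query_dec R).
Proof.
exists reduction; split=> [phi h3|].
  split; first exact: reduction_valid.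
  rewrite /= reduction_yes_iff; split.
    exact: satisfiable_circuit.
  by case=> w; apply: circuit_satisfiable.
have [c h] := reduction_computes.
exists (machine reduction_prog), (c%:P * ('X + 1) ^+ 3)%R => phi h3 /=.
have -> : ((c%:P * ('X + 1) ^+ 3 : {poly nat}).[size (enc_cnf phi)])%R =
    c * (size (enc_cnf phi)).+1 ^ 3.
  rewrite hornerM hornerC horner_exp hornerD hornerX hornerC.
  by rewrite -[LHS]/(c * (size (enc_cnf phi) + 1) ^ 3) addn1.
by have := h phi h3; rewrite -enc_reduction.
Qed.
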